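(* Let $G$ be a non-elementary generalized Baumslag–Solitar group which is not a solvable Baumslag–Solitar group. Then any sequence of unfoldings of type II in the cyclic deformation space $\mathcal D$ of $G$ is finite; that is, there is no infinite sequence $\dots\to T_n\to\dots\to T_1\to T_0$ of trees $T_i\in\mathcal D$ in which each map $T_{i+1}\to T_i$ is a type II fold.
   Context: A generalized Baumslag–Solitar (GBS) group is the fundamental group of a finite graph of groups all of whose vertex and edge groups are infinite cyclic. It is non-elementary if it is not isomorphic to $\mathbb Z$, $\mathbb Z^2$ or the Klein bottle group $\langle a,t\mid tat^{-1}=a^{-1}\rangle$. The solvable Baumslag–Solitar groups are the groups $BS(1,n)=\langle a,t\mid tat^{-1}=a^n\rangle$, $n\in\mathbb Z\setminus\{0\}$. A $G$-tree is a simplicial tree with a minimal action of $G$ by simplicial automorphisms without inversions. The cyclic deformation space $\mathcal D$ is the set of all $G$-trees whose vertex and edge stabilizers are all infinite cyclic. Fold: let $T$ be a $G$-tree, $v$ a vertex, and $e_1,e_2$ two distinct edges with origin $v$ with $e_2\notin G\cdot\bar e_1$. The fold of $e_1$ with $e_2$ is the quotient map $T\to T/\!\sim$, where $\sim$ is the smallest $G$-invariant equivalence relation on $T$ with $e_1\sim e_2$ and $t(e_1)\sim t(e_2)$ ($t(e)$ denotes the terminal vertex of $e$). A type II fold (between trees of $\mathcal D$) is a fold of two edges $e_1,e_2$ with common origin $v$ that lie in the same orbit, $e_2=he_1$ with $h\in G_v$, such that the origin and the endpoint of $e_1$ are in different $G$-orbits. (For such a fold, the folded tree is in the same deformation space as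 the original one if and only if $G_{e_1}=G_{t(e_1)}$; in the body of the paper such folds are called folds of type C.) An unfolding is the inverse of a fold. *)

(* Defs.v *)
From HB Require Import structures.
From mathcomp Require Import all_boot all_order all_algebra all_classical.
From Corelib Require Import RelationClasses.

Set Implicit Arguments.
Unset Strict Implicit.
Unset Printing Implicit Defensive.

Local Open Scope classical_set_scope.

(* H is a subgroup of G isomorphic to the additive group A. *)
Definition isomorphic_to_zmod (G : groupType) (A : zmodType) (H : set G) :=
  exists f : A -> G,
    [/\ injective f, (forall x y, f (x + y)%R = (f x * f y)%g) & range f = H].

Definition infinite_cyclic (G : groupType) (H : set G) :=
  isomorphic_to_zmod int H.

(* A word in X is a list of letters (x, b); b = true marks the inverse of x. *)
Definition word (X : Type) := seq (X * bool).

Definition eval_word (X : Type) (G : groupType) (f : X -> G) (w : word X) : G :=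
  (\prod_(l <- w) (if l.2 then (f l.1)^-1 else f l.1))%g.

(* Equality of words in the group < X | u = v for all u, v with R u v >. *)
Inductive word_eq (X : Type) (R : word X -> word X -> Prop) :
    word X -> word X -> Prop :=
| weq_refl u : word_eq R u u
| weq_sym u v : word_eq R u v -> word_eq R v u
| weq_trans u v w : word_eq R u v -> word_eq R v w -> word_eq R u w
| weq_cat u u' v v' :
    word_eq R u u' -> word_eq R v v' -> word_eq R (u ++ v) (u' ++ v')
| weq_cancel x b : word_eq R [:: (x, b); (x, ~~ b)] [::]
| weq_rel u v : R u v -> word_eq R u v.

(* G is isomorphic to < X | R >. *)
Definition presented_by (G : groupType) (X : Type)
    (R : word X -> word X -> Prop) :=
  exists f : X -> G,
    (forall g, exists w, eval_word f w = g) /\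
    (forall u v, eval_word f u = eval_word f v <-> word_eq R u v).

Inductive bs_gen := bs_a | bs_t.

Definition bs_a_power (n : int) : word bs_gen :=
  nseq `|n|%N (bs_a, (n < 0)%R).

(* t a t^-1 = a^n *)
Inductive bs_rel (n : int) : word bs_gen -> word bs_gen -> Prop :=
| bs_relI :
    bs_rel n [:: (bs_t, false); (bs_a, false); (bs_t, true)] (bs_a_power n).

Definition solvable_BS (G : groupType) :=
  exists2 n : int, n <> 0%R & presented_by G (bs_rel n).

Definition klein_bottle_group (G : groupType) := presented_by G (bs_rel (-1)%R).

Definition non_elementary (G : groupType) :=
  [/\ ~ isomorphic_to_zmod int [set: G],
      ~ isomorphic_to_zmod (int * int)%type [set: G]
    & ~ klein_bottle_group G].

(* Graphs in the sense of Serre; edges are oriented. *)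
Record graph := Graph {
  vert : Type;
  edge : Type;
  org : edge -> vert;
  bar : edge -> edge;
  barK : involutive bar;
  bar_neq : forall e, bar e <> e
}.

Definition tgt (X : graph) (e : edge X) : vert X := org (bar e).

(* p is an edge path from x to y all of whose edges lie in SE. *)
Fixpoint walk (X : graph) (SE : set (edge X)) (x : vert X) (p : seq (edge X))
    (y : vert X) : Prop :=
  if p is e :: p' then [/\ SE e, org e = x & walk SE (tgt e) p' y] else x = y.

Definition reduced (X : graph) (p : seq (edge X)) :=
  forall p1 e p2, p <> p1 ++ [:: e, bar e & p2].

(* (SV, SE) is a subgraph, and it is a tree: nonempty, connected, without    *)
(* circuits.                                                                 *)
Definition subtree (X : graph) (SV : set (vert X)) (SE : set (edge X)) :=
  [/\ forall e, SE e -> SV (org e) /\ SE (bar e),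
      SV !=set0,
      forall x y, SV x -> SV y -> exists p, walk SE x p y
    & forall x p, walk SE x p x -> reduced p -> p = [::]].

Definition is_tree (X : graph) := subtree [set: vert X] [set: edge X].

Definition spanning_tree (X : graph) (SE : set (edge X)) :=
  subtree [set: vert X] SE.

(* An orientation is fixed: gg_edge has one element per geometric edge, so   *)
(* that an edge and its inverse share one edge group.                        *)
Record graph_of_groups := GraphOfGroups {
  gg_vert : finType;
  gg_edge : finType;
  gg_src : gg_edge -> gg_vert;
  gg_tgt : gg_edge -> gg_vert;
  gg_vgrp : gg_vert -> groupType;
  gg_egrp : gg_edge -> groupType;
  gg_isrc : forall a, {multiplicative gg_egrp a -> gg_vgrp (gg_src a)};
  gg_itgt : forall a, {multiplicative gg_egrp a -> gg_vgrp (gg_tgt a)};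
  gg_isrc_inj : forall a, injective (gg_isrc a);
  gg_itgt_inj : forall a, injective (gg_itgt a)
}.

Section FundamentalGroup.
Variable Y : graph_of_groups.

(* The underlying graph: (a, false) is the edge a, (a, true) its inverse. *)
Definition gg_org (e : gg_edge Y * bool) : gg_vert Y :=
  if e.2 then gg_tgt e.1 else gg_src e.1.

Definition gg_bar (e : gg_edge Y * bool) : gg_edge Y * bool := (e.1, ~~ e.2).

Lemma gg_barK : involutive gg_bar.
Proof. by case=> a b; rewrite /gg_bar negbK. Qed.

Lemma gg_bar_neq e : gg_bar e <> e.
Proof. by case: e => a []. Qed.

Definition gg_graph : graph := Graph gg_org gg_barK gg_bar_neq.

Inductive gg_gen : Type :=
| gg_elt (v : gg_vert Y) (x : gg_vgrp v)
| gg_stable (a : gg_edge Y).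

(* Relations of the fundamental group with respect to a maximal tree SE. *)
Inductive gg_rel (SE : set (edge gg_graph)) :
    word gg_gen -> word gg_gen -> Prop :=
| gg_rel_vert v (x y : gg_vgrp v) :
    gg_rel SE [:: (gg_elt x, false); (gg_elt y, false)]
              [:: (gg_elt (x * y)%g, false)]
| gg_rel_edge a (c : gg_egrp a) :
    gg_rel SE [:: (gg_stable a, false); (gg_elt (gg_itgt a c), false);
                  (gg_stable a, true)]
              [:: (gg_elt (gg_isrc a c), false)]
| gg_rel_tree a : SE (a, false) -> gg_rel SE [:: (gg_stable a, false)] [::].

(* The fundamental group is independent of the maximal tree up to            *)
(* isomorphism; existence of one says that the graph is connected.           *)
Definition fundamental_group (G : groupType) :=
  exists2 SE : set (edge gg_graph), spanning_tree SE & presented_by G (gg_rel SE).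

End FundamentalGroup.

Definition GBS_group (G : groupType) :=
  exists Y : graph_of_groups,
    [/\ forall v, infinite_cyclic [set: gg_vgrp (g:=Y) v],
        forall a, infinite_cyclic [set: gg_egrp (g:=Y) a]
      & fundamental_group Y G].

Record gtree (G : groupType) := GTree {
  gt_graph :> graph;
  gt_tree : is_tree gt_graph;
  actv : G -> vert gt_graph -> vert gt_graph;
  acte : G -> edge gt_graph -> edge gt_graph;
  actv1 : forall x, actv 1%g x = x;
  acte1 : forall e, acte 1%g e = e;
  actvM : forall g h x, actv (g * h)%g x = actv g (actv h x);
  acteM : forall g h e, acte (g * h)%g e = acte g (acte h e);
  acte_org : forall g e, org (acte g e) = actv g (org e);
  acte_bar : forall g e, bar (acte g e) = acte g (bar e);
  no_inversion : forall g e, acte g e <> bar e;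
  minimal_action : forall (SV : set (vert gt_graph)) (SE : set (edge gt_graph)),
    subtree SV SE ->
    (forall g x, SV x -> SV (actv g x)) ->
    (forall g e, SE e -> SE (acte g e)) ->
    SV = [set: vert gt_graph] /\ SE = [set: edge gt_graph]
}.

Section Folds.
Variable G : groupType.
Implicit Types T : gtree G.

Definition stabv T (x : vert T) : set G := [set g | actv g x = x].
Definition stabe T (e : edge T) : set G := [set g | acte g e = e].

Definition in_cyclic_deformation_space T :=
  (forall x : vert T, infinite_cyclic (stabv x)) /\
  (forall e : edge T, infinite_cyclic (stabe e)).

(* The smallest G-invariant equivalence relation identifying e1 with e2 (as  *)
(* oriented edges, hence bar e1 with bar e2) and tgt e1 with tgt e2, on      *)
(* vertices and on edges respectively.                                       *)
Definition fold_eqv T (e1 e2 : edge T) (x y : vert T) :=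
  forall R : vert T -> vert T -> Prop,
    Equivalence R ->
    (forall g x' y', R x' y' -> R (actv g x') (actv g y')) ->
    R (tgt e1) (tgt e2) ->
    R x y.

Definition fold_eqe T (e1 e2 : edge T) (e f : edge T) :=
  forall R : edge T -> edge T -> Prop,
    Equivalence R ->
    (forall g e' f', R e' f' -> R (acte g e') (acte g f')) ->
    (forall e' f', R e' f' -> R (bar e') (bar f')) ->
    R e1 e2 ->
    R e f.

(* T' is, up to equivariant isomorphism, the quotient of T by that relation. *)
Definition fold_of T T' (e1 e2 : edge T) :=
  [/\ org e1 = org e2, e1 <> e2, forall g, e2 <> acte g (bar e1)
    & exists (fv : vert T -> vert T') (fe : edge T -> edge T'),
      [/\ (forall e, org (fe e) = fv (org e)) /\
          (forall e, bar (fe e) = fe (bar e)),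
          (forall g x, fv (actv g x) = actv g (fv x)) /\
          (forall g e, fe (acte g e) = acte g (fe e)),
          (forall x', exists x, fv x = x') /\ (forall e', exists e, fe e = e'),
          forall x y, fv x = fv y <-> fold_eqv e1 e2 x y
        & forall e f, fe e = fe f <-> fold_eqe e1 e2 e f]].

Definition type_II_fold T T' :=
  exists (e1 e2 : edge T) (h : G),
    [/\ fold_of T' e1 e2, stabv (org e1) h, e2 = acte h e1
      & forall g, tgt e1 <> actv g (org e1)].

End Folds.

(* Main.v *)
Require Import Defs.
From mathcomp Require Import all_boot all_order all_algebra all_classical.
From Corelib Require Import RelationClasses.
From Corelib Require Morphisms Setoid.

(** Fold maps do not change the quotient graph X = T / G: two edges of one
    orbit are identified, and by [fold_vert_orbit] and [fold_edge_orbit] nothing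
    outside an orbit is.  What changes are the labels [G_o(e) : G_e] of the
    oriented edges e of X.  Let T -> T' be a type II fold of e1 = vw with h e1.
    A short circuit argument gives G_w = G_e1 ([stab_tgt_e1]); the edge fe e1 and
    the vertex fv w have the same stabilizer K, which properly contains G_e1, and
    all stabilizers outside the orbits of e1 and w are preserved.  So, with
    k = [K : G_e1] > 1, passing from T' to T ([fold_move]) multiplies the label of
    e1 by k and divides by k the labels of all other edges that leave w, while the
    label of the inverse of e1 is 1.

    X is finite, because G is finitely generated and its action is minimal.
    Consider an infinite sequence of such moves, and call an edge recurrent if it
    is moved infinitely often.  A label that is divided infinitely often must be
    multiplied infinitely often, so all edges that continue a recurrent edge are
    recurrent ([succ_recurrent]).  The product of all labels never increases, and
    decreases when the end of the moved edge has valence at least 3; hence the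
    continuation of a recurrent edge e is unique, the recurrent edges form
    cycles through vertices of valence 2, and by connectedness they make X a circle.
    On this circle, factors of labels travel backwards on the recurrent edges and
    forwards on their inverses, and neither can pass a vertex where the
    other sits.  If both kinds existed, a pair of them facing each
    other at minimal distance would be stuck forever ([no_gap]).  So from some
    time on all inverses of recurrent edges have label 1
    ([bar_recurrent_lam1]).

    In such a tree T every vertex x has exactly one edge in the backward
    direction, leading to a vertex parent x, and G_x fixes it: G fixes an
    end.  If parent^r x = t x with r > 0 minimal and a generates G_x, then
    t^-1 a t = a^n for some n <> 0, and common ancestors show that every element
    of G is of the form t^b a^m t^-c.  This makes G the group BS(1, n)
    ([fixed_end_solvable_BS]), which is excluded. *)

Set Implicit Arguments.
Unset Strict Implicit.
Unset Printing Implicit Defensive.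
Import Order.TTheory GRing.Theory Num.Theory.
Local Open Scope ring_scope.
Local Open Scope nat_scope.

(** * Unfoldings as moves on a finite labelled graph *)

Lemma eventually_constant (u : nat -> nat) n :
  (forall t, n <= t -> u t.+1 <= u t) ->
  exists2 t1, n <= t1 & forall t, t1 <= t -> u t.+1 = u t.
Proof.
move=> u_le.
have exP : exists m, `[< exists2 t, n <= t & u t = m >].
  by exists (u n); apply/asboolP; exists n.
case: (ex_minnP exP) => m /asboolP[t1 le_n_t1 <-] m_min; exists t1 => // t le_t1_t.
have le_u s : t1 <= s -> u s = u t1.
  elim: s => [|s IHs]; first by rewrite leqn0 => /eqP->.
  rewrite leq_eqVlt => /orP[/eqP-> //|]; rewrite ltnS => le_t1_s.
  apply/eqP; rewrite eqn_leq -{1}(IHs le_t1_s) u_le ?(leq_trans le_n_t1) //=.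
  by apply/m_min/asboolP; exists s.+1 => //; rewrite ltnW // ltnS (leq_trans le_n_t1).
by rewrite !le_u // ltnW.
Qed.

Section Moves.
Variables (V : Type) (E : finType) (orgE : E -> V) (barE : E -> E).
Hypothesis barEK : involutive barE.
Hypothesis barE_neq : forall e, barE e <> e.

(** f continues a path through e without backtracking. *)
Definition succ (e f : E) := orgE f = orgE (barE e) /\ f <> barE e.

(** The effect of an unfolding by k at the edge g on the labels: lam belongs to the
    folded graph, lam' to the unfolded one. *)
Record move (lam lam' : E -> nat) (g : E) (k : nat) : Prop := Move {
  move_gt1 : 1 < k;
  move_bar1 : lam (barE g) = 1;
  move_noloop : orgE (barE g) <> orgE g;
  move_succ : exists f, succ g f;
  move_gain : lam' g = k * lam g;
  move_loss : forall f, succ g f -> lam f = k * lam' f;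
  move_id : forall f, f <> g -> ~ succ g f -> lam' f = lam f
}.

Lemma succ_neq lam lam' g k f : move lam lam' g k -> succ g f -> f <> g.
Proof. by move=> mv [og _] fg; apply: (move_noloop mv); rewrite -og fg. Qed.

(** Each of the edges that continue g loses a factor k, and g alone gains one. *)
Lemma move_prod lam lam' g k : move lam lam' g k ->
  (\prod_e lam' e) * k ^ #|[pred f | `[< succ g f >]]| = (\prod_e lam e) * k.
Proof.
move=> mv.
have pk (P : pred E) : \prod_e (if P e then k else 1) = k ^ #|P|.
  by rewrite -big_mkcond prod_nat_const.
have -> : (\prod_e lam e) * k = (\prod_e lam e) * \prod_e (if pred1 g e then k else 1).
  by rewrite pk card1 expn1.
rewrite -pk -!big_split /=; apply: eq_bigr => f _.
case: asboolP => sf.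
  by rewrite (move_loss mv sf) mulnC; case: eqP => [/(succ_neq mv sf)|] //; rewrite muln1.
rewrite muln1; case: eqP => [->|fg]; first by rewrite (move_gain mv) mulnC.
by rewrite muln1 (move_id mv).
Qed.

Variables (lam : nat -> E -> nat) (m : nat -> E) (k : nat -> nat).
Hypothesis lam_gt0 : forall t e, 0 < lam t e.
Hypothesis mvP : forall t, move (lam t) (lam t.+1) (m t) (k t).

Definition recurrent e := forall n, exists2 t, n <= t & m t = e.

Lemma eventually_recurrent :
  exists n, forall t, n <= t -> recurrent (m t).
Proof.
have /choice[b bP] : forall e, exists n, forall t, n <= t -> m t = e -> recurrent e.
  move=> e; case: (pselect (recurrent e)) => [re|]; first by exists 0.
  move/existsNP => [n nP]; exists n => t le_nt mt; exfalso; apply: nP.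
  by exists t.
exists (\max_e b e) => t le_t; apply: (bP (m t) t) => //.
exact: leq_trans (leq_bigmax (m t)) le_t.
Qed.

(** The label of f is divided at each move of e; without moves of f itself it
    would decrease forever. *)
Lemma succ_recurrent e f : recurrent e -> succ e f -> recurrent f.
Proof.
move=> re sf; apply: contrapT => /existsNP[n nP].
have nmf t : n <= t -> f <> m t by move=> le_nt fm; apply: nP; exists t.
have lam_le t : n <= t -> lam t.+1 f <= lam t f.
  move=> le_nt; case: (pselect (succ (m t) f)) => [sm|nsm].
    by rewrite (move_loss (mvP t) sm) leq_pmull // ltnW // (move_gt1 (mvP t)).
  by rewrite (move_id (mvP t)) //; apply: nmf.
have [t1 le_n_t1 cst] := eventually_constant lam_le.
have [t le_t mt] := re t1; have := move_loss (mvP t); rewrite mt => /(_ f sf).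
rewrite (cst _ le_t) => /eqP; rewrite -[X in X == _]mul1n eqn_pmul2r ?lam_gt0 //.
by have := move_gt1 (mvP t); case: (k t) => [|[]].
Qed.

(** By [move_prod], the product of all labels is nonincreasing, hence eventually
    constant, and it can be constant at a move of e only if e has one continuation. *)
Lemma recurrent_succ_unique e : recurrent e -> exists f, succ e f /\ forall f', succ e f' -> f' = f.
Proof.
move=> re; pose P t := \prod_e lam t e.
have P_gt0 t : 0 < P t by apply: prodn_gt0.
have eqP' t : P t.+1 * _ = P t * k t := move_prod (mvP t).
have P_le t : 0 <= t -> P t.+1 <= P t.
  move=> _; have := eqP' t; have [f sf] := move_succ (mvP t).
  have k_gt0 : 0 < k t by apply: ltnW (move_gt1 (mvP t)).
  rewrite (cardD1 f) inE; move/asboolP: (sf) => -> /=.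
  rewrite expnS mulnCA [RHS]mulnC => /eqP; rewrite eqn_pmul2l // => /eqP<-.
  by rewrite leq_pmulr // expn_gt0 k_gt0.
have [t1 _ cst] := eventually_constant P_le.
have [t le_t mt] := re t1; move: (eqP' t); rewrite (cst _ le_t) mt => /eqP.
rewrite eqn_pmul2l // -[X in _ == X]expn1 eqn_exp2l ?(move_gt1 (mvP t)) //.
move=> /eqP/mem_card1[f fP]; exists f; split=> [|f' /asboolP sf].
  by apply/asboolP; have := fP f; rewrite unfold_in /= => ->; rewrite inE eqxx.
by apply/eqP; have := fP f'; rewrite unfold_in /= sf inE => <-.
Qed.

Section Next.
Variable next : E -> E.
Hypothesis next_succ : forall e, recurrent e -> succ e (next e).
Hypothesis next_unique : forall e f, recurrent e -> succ e f -> f = next e.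

Lemma next_recurrent e : recurrent e -> recurrent (next e).
Proof. by move=> re; apply: (succ_recurrent re); apply: next_succ. Qed.

Lemma iter_next_recurrent e i : recurrent e -> recurrent (iter i next e).
Proof. by move=> re; elim: i => //= i; apply: next_recurrent. Qed.

(** The end of a recurrent edge has valence 2. *)
Lemma at_target e f : recurrent e -> orgE f = orgE (barE e) -> f = barE e \/ f = next e.
Proof.
move=> re og; case: (pselect (f = barE e)) => [|nf]; [by left | right].
exact: next_unique.
Qed.

Lemma next_inj e e' : recurrent e -> recurrent e' -> next e = next e' -> e = e'.
Proof.
move=> re re' ee'; have [oe ne] := next_succ re; have [oe' ne'] := next_succ re'.
have /(at_target re) [/(can_inj barEK)//|bn] : orgE (barE e') = orgE (barE e).
  by rewrite -oe -oe' ee'.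
by case: ne'; rewrite bn ee'.
Qed.

(** On a chain of vertices of valence 2, the inverses of the edges follow one another
    in the opposite order. *)
Lemma succ_bar g e : recurrent g -> recurrent e -> next g = barE e -> g = barE (next e).
Proof.
move=> rg re gE; have [og ng] := next_succ rg.
have /(at_target re) [/(can_inj barEK) ge|<-] : orgE (barE g) = orgE (barE e); first by rewrite -gE.
  by case: (next_succ re) => _ []; rewrite -gE ge.
by rewrite barEK.
Qed.

(** Were it false, pulling both ends of the path from e to its inverse one
    step inwards would lead to an edge equal to, or followed by, its own inverse. *)
Lemma iter_next_neq_bar e d : recurrent e -> iter d next e <> barE e.
Proof.
elim/ltn_ind: d e => -[|[|d]] IH e re /=.
- by move/esym; apply: barE_neq.
- by case: (next_succ re).
- move/(succ_bar (iter_next_recurrent d.+1 re) re).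
  by rewrite iterSr; apply: (IH d) => //; apply: next_recurrent.
Qed.

Lemma next_periodic e : recurrent e -> exists2 n, 0 < n & iter n next e = e.
Proof.
move=> re; pose h (i : 'I_#|E|.+1) := iter i next e.
have /injectivePn[i [j nij hij]] : ~~ injectiveb h.
  by apply/negP => /injectiveP/leq_card; rewrite card_ord ltnn.
wlog lt_ij : i j nij hij / i < j.
  move=> wl; case: (ltngtP i j) => [lt|lt|/val_inj eij]; first exact: (wl i j).
    by apply: (wl j i) => //; rewrite eq_sym.
  by rewrite eij eqxx in nij.
exists (j - i); first by rewrite subn_gt0.
have : iter i next e = iter i next (iter (j - i) next e).
  by rewrite -iterD subnKC // ltnW.
move: (j - i) => d.
elim: (i : nat) => [/esym|n IHn] // /= /next_inj hn; apply: IHn; apply: hn.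
  exact: iter_next_recurrent.
by rewrite -iterD; apply: iter_next_recurrent.
Qed.

Variable t0 : nat.
Hypothesis t0P : forall t, t0 <= t -> recurrent (m t).

(** A move can make a label trivial only at the edge that it divides. *)
Lemma lam_step_neq1 t f : t0 <= t -> lam t f <> 1 ->
  next (m t) <> f -> lam t.+1 f <> 1.
Proof.
move=> le_t nf nmf; have rm := t0P le_t.
have [->|nfm] := eqVneq f (m t).
  rewrite (move_gain (mvP t)) => /eqP; rewrite muln_eq1 => /andP[/eqP k1 _].
  by have := move_gt1 (mvP t); rewrite k1.
rewrite (move_id (mvP t)) //; first exact/eqP.
by move/(next_unique rm) => /esym.
Qed.

Lemma lam_gain_neq1 t : lam t.+1 (m t) <> 1.
Proof.
rewrite (move_gain (mvP t)) => /eqP; rewrite muln_eq1 => /andP[/eqP k1 _].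
by have := move_gt1 (mvP t); rewrite k1.
Qed.

(** A nontrivial label on the inverse of e faces a nontrivial label d + 1 edges
    ahead of e.  A move that changes either of the two brings a nontrivial label
    one step closer, which is excluded by induction on d; when d = 0 the two
    labels sit at the same vertex and block each other.  So both labels stay
    nontrivial, but every later move of e requires the first one to be 1. *)
Lemma no_gap d t e : t0 <= t -> recurrent e ->
  lam t (barE e) <> 1 -> lam t (iter d next (next e)) = 1.
Proof.
elim/ltn_ind: d t e => d IH t e le_t re nB; apply: contrapT => nF.
have forever s : t <= s -> lam s (barE e) <> 1 /\ lam s (iter d next (next e)) <> 1.
  elim: s => [|s IHs]; first by rewrite leqn0 => /eqP t_0; rewrite t_0 in nB nF.
  rewrite leq_eqVlt => /orP[/eqP<- //|]; rewrite ltnS => le_ts.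
  have [nBs nFs] := IHs le_ts; clear IHs; have le_s := leq_trans le_t le_ts.
  have rm := t0P le_s; have rn := next_recurrent re.
  have neqFB : iter d next (next e) <> barE e.
    by rewrite -iterSr; apply: iter_next_neq_bar.
  case: (pselect (next (m s) = barE e)) => [mB|mB].
    have mE := succ_bar rm re mB.
    have := move_bar1 (mvP s); rewrite mE barEK => ne1.
    case: d nF nFs neqFB IH => [|d] nF nFs neqFB IH; first by case: nFs.
    exfalso; move: (IH d (ltnSn d) s.+1 (next e)); rewrite -iterSr.
    have F' : lam s.+1 (iter d.+1 next (next e)) <> 1.
      by apply: lam_step_neq1 => //; rewrite mB => /esym.
    move=> h; apply: F'; apply: h => //; first exact: (leq_trans le_s).
    by rewrite -mE; apply: lam_gain_neq1.
  case: (pselect (next (m s) = iter d next (next e))) => [mF|mF]; last first.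
    by split; apply: lam_step_neq1.
  have B' : lam s.+1 (barE e) <> 1 by apply: lam_step_neq1.
  have mE : m s = iter d next e.
    by apply: next_inj => //; [apply: iter_next_recurrent | rewrite mF -iterSr].
  case: d nF nFs neqFB IH mF mE => [|d] nF nFs neqFB IH mF mE.
    by case: nBs; have := move_bar1 (mvP s); rewrite mE.
  exfalso; have := @lam_gain_neq1 s; rewrite mE iterSr; apply.
  by apply: IH => //; apply: (leq_trans le_s).
have [s le_s ms] := re t; have [] := forever s le_s.
by have := move_bar1 (mvP s); rewrite ms.
Qed.

(** A nontrivial label on the inverses never disappears but only travels along the cycle,
    so it still exists when e is moved next, and then the label of next e is
    nontrivial as well: the situation of [no_gap]. *)
Lemma bar_recurrent_lam1 t e : t0 <= t -> recurrent e -> lam t (barE e) = 1.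
Proof.
move=> le_t re; apply: contrapT => nB.
have persist s : t <= s -> exists i, lam s (barE (iter i next e)) <> 1.
  elim: s => [|s IHs]; first by rewrite leqn0 => /eqP t_0; exists 0; move: nB; rewrite t_0.
  rewrite leq_eqVlt => /orP[/eqP<- //|]; first by exists 0.
  rewrite ltnS => le_ts; have [i nBi] := IHs le_ts; have le_s := leq_trans le_t le_ts.
  have ri := iter_next_recurrent i re.
  case: (pselect (next (m s) = barE (iter i next e))) => [mB|mB].
    by exists i.+1; rewrite /= -(succ_bar (t0P le_s) ri mB); apply: lam_gain_neq1.
  by exists i; apply: lam_step_neq1.
have [s le_s ms] := re t; have [i nBi] := persist s le_s.
have [n n_gt0 nE] := next_periodic re.
have := no_gap (n * i - i) (leq_trans le_t le_s) (iter_next_recurrent i re) nBi.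
have iE : iter (n * i) next e = e.
  by elim: i {nBi} => [|i IHi]; rewrite ?muln0 // mulnS iterD IHi.
rewrite -iterSr -iterD addSn subnK ?leq_pmull //= iE.
have := move_loss (mvP s); rewrite ms => /(_ _ (next_succ re)) -> /eqP.
by rewrite muln_eq1 => /andP[/eqP k1 _]; have := move_gt1 (mvP s); rewrite k1.
Qed.

End Next.

(** U consists of the inverses of the recurrent edges.  The last two properties say that
    the edges of U and their inverses are closed under adjacency. *)
Theorem infinite_moves_circle : exists (t : nat) (U : set E),
  [/\ exists u, U u,
      forall u, U u -> lam t u = 1,
      forall u, U u -> ~ U (barE u),
      forall u e, U u -> orgE e = orgE u -> e = u \/ U (barE e)
    & forall u, U u -> exists2 u', U u' & orgE (barE u) = orgE u'].
Proof.
have [t0 t0P] := eventually_recurrent.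
have /choice[next nextP] : forall e, exists f,
    recurrent e -> succ e f /\ forall f', succ e f' -> f' = f.
  move=> e; case: (pselect (recurrent e)) => [/recurrent_succ_unique[f fP]|nr].
    by exists f.
  by exists e.
have ns e (re : recurrent e) := (nextP e re).1.
have nu e f (re : recurrent e) := (nextP e re).2 f.
have lam1 t e : t0 <= t -> recurrent e -> lam t (barE e) = 1.
  exact: (bar_recurrent_lam1 ns nu t0P).
exists t0, (fun u => recurrent (barE u)); split=> /=.
- by exists (barE (m t0)); rewrite barEK; apply: t0P.
- by move=> u /(lam1 t0 _ (leqnn _)); rewrite barEK.
- move=> u ru; rewrite barEK => /(_ t0) [t le_t mt].
  by apply: (@lam_gain_neq1 t); rewrite mt -[u]barEK lam1 // leqW.
- move=> u e ru oe.
  have := @at_target next nu _ e ru; rewrite barEK => /(_ oe)[->|->]; first by left.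
  by right; rewrite barEK; apply: (@next_recurrent next).
- move=> u ru; have [[//|n] _ nE] := next_periodic ns nu ru.
  have rn := iter_next_recurrent ns n ru.
  exists (barE (iter n next (barE u))); first by rewrite /= barEK.
  by rewrite -(ns _ rn).1 -iterS nE.
Qed.

End Moves.

Local Open Scope classical_set_scope.
Local Open Scope group_scope.

(** * Indices in infinite cyclic groups *)

Section Cyclic.
Variable G : groupType.
Implicit Types H K L : set G.

Definition expn_into H K j := forall h, H h -> K (h ^+ j).

(** For infinite cyclic K <= H, the index of K in H, because H / K is cyclic: its
    multiples are the j for which K contains all j-th powers of H.  This
    characterization involves no generators, so invariance under conjugation is
    immediate. *)
Definition subgroup_index H K : nat :=
  xget 0 (fun m : nat => forall j, expn_into H K j <-> m %| j).

Lemma subgroup_index_unique H K m :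
  (forall j, expn_into H K j <-> m %| j) -> subgroup_index H K = m.
Proof.
move=> mP; apply: xget_unique => // m' m'P; apply/eqP; rewrite eqn_dvd.
by apply/andP; split; [apply/m'P/mP | apply/mP/m'P].
Qed.

Section Param.
Variables (f : int -> G) (H : set G).
Hypothesis (f_inj : injective f) (fD : forall x y, f (x + y)%R = f x * f y)
  (fH : range f = H).

Lemma param0 : f 0%R = 1.
Proof. by apply: (mulgI (f 0%R)); rewrite -fD addr0 mulg1. Qed.

Lemma paramN x : f (- x)%R = (f x)^-1.
Proof. by apply: (mulgI (f x)); rewrite -fD subrr param0 mulgV. Qed.

Lemma paramX x n : f (x *+ n)%R = f x ^+ n.
Proof. by elim: n => [|n IHn]; rewrite ?mulr0n ?param0 // mulrS fD IHn expgS. Qed.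

Lemma param_mem x : H (f x).
Proof. by rewrite -fH; exists x. Qed.

Lemma param_abs x : f x = f (`|x|%N%:Z)%R \/ f x = (f (`|x|%N%:Z)%R)^-1.
Proof.
case: (intP x) => [|n|n]; [by left | by left | right].
by rewrite abszN paramN.
Qed.

Lemma param_pow x : f x = f 1%R ^+ `|x|%N \/ f x = f 1%R ^- `|x|%N.
Proof.
by rewrite -paramX; case: (param_abs x) => ->; rewrite natz; [left | right].
Qed.

End Param.

Lemma cyclic_closed H : infinite_cyclic H ->
  [/\ H 1, forall x y, H x -> H y -> H (x * y) & forall x, H x -> H x^-1].
Proof.
case=> f [f_inj fD fH]; rewrite -fH; split=> [|_ _ [x _ <-] [y _ <-]|_ [x _ <-]].
- by exists 0%R => //; apply: (param0 fD).
- by exists (x + y)%R.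
- by exists (- x)%R => //; apply: (paramN fD).
Qed.

Lemma cyclic_commute H x y : infinite_cyclic H -> H x -> H y -> x * y = y * x.
Proof.
by case=> f [f_inj fD <-] [a _ <-] [b _ <-]; rewrite -!fD addrC.
Qed.

Lemma expn_into_param f H K j : (forall x y, f (x + y)%R = f x * f y) ->
  range f = H -> infinite_cyclic K -> expn_into H K j <-> K (f j%:Z).
Proof.
move=> fD fH /cyclic_closed[K1 KM KV]; split=> [HK|Kj h].
  by rewrite -natz paramX //; apply: HK; apply: (param_mem fH).
rewrite -fH => -[x _ <-]; rewrite -paramX // -mulr_natl mulrC natz.
have KX g n : K g -> K (g ^+ n).
  by move=> Kg; elim: n => [|n IHn]; rewrite ?expgS //; apply: KM.
case: (intP x) => [|n|n]; first by rewrite mul0r param0.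
  by rewrite -natz mulr_natl paramX //; apply: KX.
by rewrite mulNr paramN // -[n.+1%:Z]natz mulr_natl paramX //; apply/KV/KX.
Qed.

Lemma subgroup_indexP H K : infinite_cyclic H -> infinite_cyclic K -> (forall g, K g -> H g) ->
  0 < subgroup_index H K /\ forall j, expn_into H K j <-> subgroup_index H K %| j.
Proof.
move=> [f [f_inj fD fH]] cK KH.
have intoE j := expn_into_param j fD fH cK.
have [f' [f'_inj f'D f'K]] := cK.
have [z _ fz] : range f (f' 1%R) by rewrite fH; apply: KH; rewrite -f'K; exists 1%R.
have z_neq0 : z != 0%R.
  apply/eqP => z0; have := @f'_inj 1%R 0%R.
  by rewrite -fz z0 !param0 // => /(_ erefl).
suff mP j : expn_into H K j <-> `|z|%N %| j by rewrite (subgroup_index_unique mP) absz_gt0.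
rewrite intoE -f'K.
have f'E x : f' x = f (x * z)%R.
  case: (intP x) => [|n|n]; first by rewrite mul0r !param0.
    by rewrite -natz mulr_natl !paramX // fz.
  by rewrite mulNr !paramN // -[n.+1%:Z]natz mulr_natl !paramX // fz.
split=> [[x _ ]|/dvdnP[q ->]].
  by rewrite f'E => /f_inj /(congr1 absz); rewrite abszM absz_nat => <-; apply: dvdn_mull.
exists (sgz z * q%:Z)%R => //; rewrite f'E mulrAC; congr f.
by rewrite PoszM mulrC abszEsg.
Qed.

Lemma subgroup_index_eq1 H K : infinite_cyclic H -> infinite_cyclic K -> (forall g, K g -> H g) ->
  subgroup_index H K = 1%N <-> forall g, H g -> K g.
Proof.
move=> cH cK KH; have [_ mP] := subgroup_indexP cH cK KH.
have := mP 1%N; rewrite dvdn1 => -[m1 m2]; split=> [/eqP/m2 h g|h].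
  by rewrite -[g in K g]expg1; apply: h.
by apply/eqP/m1 => g; rewrite expg1; apply: h.
Qed.

(** Write H^j for the set of j-th powers.  If H^j <= L then H^j <= K, so
    j = [H : K] q.  A generator of K is the [H : K]-th power of one of H, so that
    K^q <= L. *)
Lemma subgroup_indexM H K L : infinite_cyclic H -> infinite_cyclic K -> infinite_cyclic L ->
  (forall g, K g -> H g) -> (forall g, L g -> K g) ->
  subgroup_index H L = (subgroup_index H K * subgroup_index K L)%N.
Proof.
move=> cH cK cL KH LK.
have [m_gt0 mP] := subgroup_indexP cH cK KH; have [n_gt0 nP] := subgroup_indexP cK cL LK.
set m := subgroup_index H K in m_gt0 mP *; set n := subgroup_index K L in n_gt0 nP *.
apply: subgroup_index_unique => j; split=> [HL|/dvdnP[q ->] h Hh]; last first.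
  rewrite mulnCA expgnA; have /nP : n %| q * n by apply: dvdn_mull.
  by apply; have /mP := dvdnn m; apply.
have /dvdnP[q jE] : m %| j by apply/mP => h Hh; apply/LK/HL.
rewrite jE mulnC dvdn_pmul2r //; apply/nP => g Kg.
have [f [f_inj fD fH]] := cH.
have [z _ fz] : range f g by rewrite fH; apply: KH.
have intoK i := expn_into_param i fD fH cK.
have [K1 KM KV] := cyclic_closed cK; have [L1 LM LV] := cyclic_closed cL.
have /dvdnP[r zE] : m %| `|z|.
  apply/mP/intoK; case: (param_abs fD z) => E; first by rewrite -E fz.
  by rewrite -[f _]invgK -E fz; apply: KV.
suff Lr : L (f `|z|%:Z ^+ q).
  by case: (param_abs fD z); rewrite fz => ->; rewrite ?expVgn //; apply: LV.
have -> : f `|z|%:Z ^+ q = f r%:Z ^+ j.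
  rewrite -(paramX fD) -(paramX fD) jE zE PoszM mulnC mulrnA.
  by rewrite -[(r%:Z *+ m)%R]mulr_natr natz.
by apply: HL; apply: (param_mem fH).
Qed.

Lemma subgroup_index_conj H K H' K' g :
  (forall x, H' x <-> H (x ^ g)) -> (forall x, K' x <-> K (x ^ g)) ->
  subgroup_index H' K' = subgroup_index H K.
Proof.
move=> HE KE; rewrite /subgroup_index; congr (xget _ _); apply/funext => m; apply/propext.
have intoE j : expn_into H' K' j <-> expn_into H K j.
  split=> into x Hx; last by apply/KE; rewrite conjXg; apply/into/HE.
  by rewrite -(conjgKV g x) -conjXg; apply/KE/into/HE; rewrite conjgKV.
by split=> mP j; rewrite -mP intoE.
Qed.

End Cyclic.

(** * Finite generation, minimality and finitely many edge orbits *)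

(** Stated as an induction principle, the form in which generation is used. *)
Definition generates (G : groupType) (F : Type) (s : F -> G) :=
  forall P : set G, P 1 -> (forall x y, P x -> P y -> P (x * y)) ->
    (forall x, P x -> P x^-1) -> (forall j, P (s j)) -> forall g, P g.

(** One generator for each vertex group and one stable letter for each edge. *)
Lemma GBS_finitely_generated (G : groupType) : GBS_group G ->
  exists (F : finType) (s : F -> G), generates s.
Proof.
case=> Y [cyc _ [SE _ [f [f_surj f_rel]]]].
pose phi v := sval (cid (cyc v)).
have phiP v : [/\ injective (phi v), (forall x y, phi v (x + y)%R = phi v x * phi v y)
    & range (phi v) = setT] := svalP (cid (cyc v)).
have f_elt v x y : f (@gg_elt Y v (x * y)) = f (gg_elt x) * f (gg_elt y).
  have /f_rel := weq_rel (gg_rel_vert SE x y).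
  by rewrite /eval_word !big_cons big_nil /= !mulg1.
exists (gg_vert Y + gg_edge Y)%type.
exists (fun j => match j with inl v => f (gg_elt (phi v 1%R)) | inr a => f (gg_stable a) end).
move=> P P1 PM PV Ps g; have [w <-] := f_surj g.
have Pf x : P (f x).
  case: x => [v x|a]; last exact: (Ps (inr a)).
  have [_ phiD phi_surj] := phiP v.
  have [z _ <-] : range (phi v) x by rewrite phi_surj.
  have hD a b : f (gg_elt (phi v (a + b)%R)) = f (gg_elt (phi v a)) * f (gg_elt (phi v b)).
    by rewrite phiD f_elt.
  have PX n : P (f (gg_elt (phi v 1%R)) ^+ n).
    elim: n => [|n IHn]; first by rewrite expg0.
    by rewrite expgS; apply: PM => //; apply: (Ps (inl v)).
  case: (@param_pow _ (fun z => f (gg_elt (phi v z))) hD z) => /= ->; first exact: PX.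
  exact/PV/PX.
rewrite /eval_word; elim: w => [|[x b] w IHw]; first by rewrite big_nil.
by rewrite big_cons; apply: PM => //; case: b => /=; [apply: PV|]; apply: Pf.
Qed.

Section Walks.
Variables (X : graph) (SE : set (edge X)).

Lemma walk_cat x p y q z : walk SE x p y -> walk SE y q z -> walk SE x (p ++ q) z.
Proof. by elim: p x => [x ->|e p IHp x [Ee <- /IHp w /w]] //=. Qed.

Lemma tgt_bar (e : edge X) : tgt (bar e) = org e.
Proof. by rewrite /tgt barK. Qed.

Lemma walk_rev x p y : (forall e, SE e -> SE (bar e)) ->
  walk SE x p y -> walk SE y (rev (map (@bar X) p)) x.
Proof.
move=> SEb; elim: p x => [x ->|e p IHp x [Ee <- /IHp w]] //=.
rewrite rev_cons -cats1; apply: (walk_cat w) => /=; split=> //; first exact: SEb.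
exact: tgt_bar.
Qed.

Lemma walk_sub (SE' : set (edge X)) x p y :
  (forall e, SE e -> SE' e) -> walk SE x p y -> walk SE' x p y.
Proof. by move=> sub; elim: p x => //= e p IHp x [/sub Ee -> /IHp]. Qed.

End Walks.

Section GTree.
Variables (G : groupType) (T : gtree G).

Lemma tgt_acte g (e : edge T) : tgt (acte g e) = actv g (tgt e).
Proof. by rewrite /tgt acte_bar acte_org. Qed.

Lemma acteK g : cancel (@acte G T g) (acte g^-1).
Proof. by move=> e; rewrite -acteM mulVg acte1. Qed.

Lemma acteKV g : cancel (@acte G T g^-1) (acte g).
Proof. by move=> e; rewrite -acteM mulgV acte1. Qed.

Lemma actvK g : cancel (@actv G T g) (actv g^-1).
Proof. by move=> e; rewrite -actvM mulVg actv1. Qed.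

Lemma actvKV g : cancel (@actv G T g^-1) (actv g).
Proof. by move=> e; rewrite -actvM mulgV actv1. Qed.

Lemma walk_act (SE : set (edge T)) g x p y :
  (forall e, SE e -> SE (acte g e)) ->
  walk SE x p y -> walk SE (actv g x) (map (acte g) p) (actv g y).
Proof.
move=> SEg; elim: p x => [x ->|e p IHp x [Ee <- /IHp w]] //=.
by split; [exact: SEg | rewrite acte_org | rewrite tgt_acte].
Qed.

Lemma tree_connected (x y : vert T) : exists p, walk [set: edge T] x p y.
Proof. by have [_ _ h _] := gt_tree T; apply: h. Qed.

Lemma tree_reduced_closed (x : vert T) p : walk [set: edge T] x p x -> reduced p -> p = [::].
Proof. by have [_ _ _ h] := gt_tree T; apply: h. Qed.

(** The component of x in the subgraph SE is then an invariant subtree. *)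
Lemma minimal_connected (SE : set (edge T)) (x : vert T) :
  (forall e, SE e -> SE (bar e)) -> (forall g e, SE e -> SE (acte g e)) ->
  (forall g, exists p, walk SE x p (actv g x)) -> SE = [set: edge T].
Proof.
move=> SEb SEg conn.
pose SV y := exists p, walk SE x p y.
pose SE' e := SE e /\ SV (org e).
have SVg g y : SV y -> SV (actv g y).
  move=> [p w]; have [q wq] := conn g; exists (q ++ map (acte g) p).
  by apply: (walk_cat wq); apply: walk_act w; apply: SEg.
have SVtgt e : SE' e -> SV (tgt e).
  by move=> [Ee [p w]]; exists (p ++ [:: e]); apply: (walk_cat w).
have walk' y p z : SV y -> walk SE y p z -> walk SE' y p z.
  elim: p y => //= e p IHp y Vy [Ee oe w]; have E'e : SE' e by rewrite /SE' oe.
  by split=> //; apply: IHp w; apply: SVtgt.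
have [||| _ E'T] := @minimal_action G T SV SE'.
- split=> [e E'e||y z [p wp] [q wq]|y p w].
  + by have [Ee Ve] := E'e; do 2!split=> //; [apply: SEb | apply: SVtgt].
  + by exists x, [::].
  + exists (rev (map (@bar T) p) ++ q).
    apply: walk'; [by exists p | by apply: walk_cat wq; apply: walk_rev].
  + by apply: tree_reduced_closed; apply: walk_sub w.
- exact: SVg.
- by move=> g e [Ee Ve]; split; [apply: SEg | rewrite acte_org; apply: SVg].
- by apply/seteqP; split=> // e _; have [] : SE' e by rewrite E'T.
Qed.

(** Otherwise deleting the orbit of the end of e would leave a smaller
    invariant subtree: a path that enters a deleted vertex has to backtrack. *)
Lemma minimal_no_leaf (e : edge T) : (forall g, org e <> actv g (tgt e)) ->
  exists f, org f = tgt e /\ f <> bar e.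
Proof.
move=> nloop; apply: contrapT => leaf.
have leafP g f : org f = actv g (tgt e) -> f = acte g (bar e).
  move=> of'; apply: contrapT => nf; apply: leaf; exists (acte g^-1 f).
  by rewrite acte_org of' actvK; split=> // fE; apply: nf; rewrite -fE acteKV.
pose W x := exists g, x = actv g (tgt e).
have Wg g x : W (actv g x) -> W x.
  by move=> [h gx]; exists (g^-1 * h); rewrite actvM -gx actvK.
pose SE f := ~ W (org f) /\ ~ W (tgt f).
suff SET : SE = setT by have [_ []] : SE e; [rewrite SET | exists 1; rewrite actv1].
apply: (minimal_connected (x := org e)) => [f [Wo Wt]|g f [Wo Wt]|g].
- by split; rewrite ?tgt_bar.
- by split; rewrite ?acte_org ?tgt_acte => /Wg.
have [p] := tree_connected (org e) (actv g (org e)).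
have Wx : ~ W (org e) by move=> [k /nloop].
have Wy : ~ W (actv g (org e)) by move/Wg.
move: (org e) (actv g (org e)) Wx Wy => x y Wx Wy.
(* shorten the walk by two edges whenever it visits a deleted vertex *)
have [n] := ubnP (size p); elim: n x p Wx => // n IHn x [|a p] Wx /=.
  by move=> _ ->; exists [::].
rewrite ltnS => lt_pn [_ ax w].
case: (pselect (W (tgt a))) => Wa; last first.
  have [p' w'] := IHn _ _ Wa lt_pn w.
  by exists (a :: p') => /=; split=> //; split=> //; rewrite ax.
case: p lt_pn w => [|b p] /= lt_pn; first by move=> ay; case: Wy; rewrite -ay.
move=> [_ ob w]; apply: (IHn x p) => //; first exact: ltnW.
have [k ak] := Wa; have bE := leafP k b (etrans ob ak).
have aE := leafP k (bar a) ak.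
by move: w; rewrite bE -aE tgt_bar ax.
Qed.

(** The translates of walks from x to the images of x under the generators
    connect the orbit of x. *)
Lemma finite_edge_orbits (F : finType) (s : F -> G) : generates s ->
  exists (F' : finType) (r : F' -> edge T), forall e, exists j g, e = acte g (r j).
Proof.
move=> gen; have [_ [x _] _ _] := gt_tree T.
have /choice[p pP] : forall j, exists p, walk setT x p (actv (s j) x).
  by move=> j; apply: tree_connected.
(* the edges of these walks, with both orientations *)
pose r (q : {j : F & 'I_(size (p j))} * bool) :=
  let e := tnth (in_tuple (p (tag q.1))) (tagged q.1) in if q.2 then bar e else e.
exists ({j : F & 'I_(size (p j))} * bool)%type, r.
pose SE e := exists q g, e = acte g (r q).
suff SET : SE = setT by move=> e; have : SE e by rewrite SET.
have SEb e : SE e -> SE (bar e).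
  by move=> [[q b] [g ->]]; exists (q, ~~ b), g; rewrite acte_bar /r; case: b; rewrite ?barK.
have SEg g e : SE e -> SE (acte g e).
  by move=> [q [h ->]]; exists q, (g * h); rewrite acteM.
apply: (minimal_connected (x := x)) => //.
apply: gen => [|g h [q wq] [q' wq']|g [q wq]|j].
- by exists [::]; rewrite /= actv1.
- exists (q ++ map (acte g) q'); apply: (walk_cat wq); rewrite actvM.
  by apply: walk_act wq'; apply: SEg.
- exists (map (acte g^-1) (rev (map (@bar T) q))); rewrite -{1}[x](actvK g).
  by apply: walk_act; [apply: SEg | apply: walk_rev].
- exists (p j); have pE e i : i < size (p j) -> SE (nth e (p j) i).
    move=> lt_i; exists (existT _ j (Ordinal lt_i), false), 1.
    by rewrite acte1 /r /= (tnth_nth e).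
  move: (p j) (actv (s j) x) (pP j) pE => l z; move: (x).
  elim: l => //= e l IHl y [_ oe w] lE; split=> //; first exact: (lE e 0).
  by apply: IHl w _ => d i; apply: (lE d i.+1).
Qed.

End GTree.

(** * Quotient graphs and the effect of a fold on labels *)

(** Two elements are equivalent exactly when the same representative is picked for them. *)
Lemma finite_quotient (X : Type) (R : X -> X -> Prop) (F : finType) (r : F -> X) :
  Equivalence R -> (forall x, exists j, R (r j) x) ->
  exists (E : finType) (c : X -> E),
    (forall a, exists x, c x = a) /\ (forall x y, c x = c y <-> R x y).
Proof.
move=> [Rrefl Rsym Rtrans] cover; pose p x := [pick j | `[< R (r j) x >]].
have pP x y : p x = p y <-> R x y.
  split=> [|Rxy].
    have [j Rj] := cover x; rewrite /p; case: pickP => [i /asboolP Ri|/(_ j)/asboolP//].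
    case: pickP => [i' /asboolP Ri' [ii']|//]; rewrite -ii' in Ri'.
    exact: Rtrans (Rsym _ _ Ri) Ri'.
  by apply: eq_pick => j; apply: asbool_equiv_eq; split=> Rj; apply: Rtrans Rj _ => //; apply: Rsym.
have pE x : `[< exists y, p y = p x >] by apply/asboolP; exists x.
exists {o : option F | `[< exists y, p y = o >]}, (fun x => Sub (p x) (pE x)); split.
  move=> [o oP]; have /asboolP[y py] := oP; exists y; exact: val_inj.
by move=> x y; rewrite -pP; split=> [/(congr1 val)//|pxy]; apply: val_inj.
Qed.

Section Quotient.
Variables (G : groupType) (V : Type) (E : finType) (orgE : E -> V) (barE : E -> E).

(** cv and ce identify the orbits of T with the vertices and edges of a fixed graph, so
    that the labels of all trees of a fold sequence live on one and the same graph. *)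
Record quotient_map (T : gtree G) (cv : vert T -> V) (ce : edge T -> E) : Prop := QuotientMap {
  quo_vert : forall x y, cv x = cv y <-> exists g, y = actv g x;
  quo_edge : forall e f, ce e = ce f <-> exists g, f = acte g e;
  quo_surj : forall c, exists e, ce e = c;
  quo_org : forall e, cv (org e) = orgE (ce e);
  quo_bar : forall e, ce (bar e) = barE (ce e)
}.

Variables (T : gtree G) (cv : vert T -> V) (ce : edge T -> E).

Definition edge_index (e : edge T) := subgroup_index (stabv (org e)) (stabe e).

Definition label (c : E) : nat := xget 0 (fun m => exists2 e, ce e = c & edge_index e = m).

Lemma stabe_stabv (e : edge T) g : stabe e g -> stabv (org e) g.
Proof. by rewrite /stabe /stabv /= -acte_org => ->. Qed.

Lemma stabv_conj g (x : vert T) k : stabv (actv g x) k <-> stabv x (k ^ g).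
Proof.
rewrite /stabv /= conjgE !actvM; split=> [->|]; first exact: actvK.
by move/(congr1 (actv g)); rewrite actvKV.
Qed.

Lemma stabe_conj g (e : edge T) k : stabe (acte g e) k <-> stabe e (k ^ g).
Proof.
rewrite /stabe /= conjgE !acteM; split=> [->|]; first exact: acteK.
by move/(congr1 (acte g)); rewrite acteKV.
Qed.

Lemma stabe_bar (e : edge T) g : stabe (bar e) g <-> stabe e g.
Proof.
rewrite /stabe /= -acte_bar; split=> [/(congr1 (@bar T))|->//].
by rewrite !barK.
Qed.

Lemma edge_index_act g (e : edge T) : edge_index (acte g e) = edge_index e.
Proof.
by apply: (subgroup_index_conj (g := g)) => k; rewrite ?acte_org ?stabv_conj ?stabe_conj.
Qed.

Hypothesis q : quotient_map cv ce.

Lemma labelE e : label (ce e) = edge_index e.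
Proof.
apply: xget_unique => [|m [f /esym/(quo_edge q)[g ->] <-]]; first by exists e.
by rewrite edge_index_act.
Qed.

Lemma quotient_barK : involutive barE.
Proof. by move=> c; have [e <-] := quo_surj q c; rewrite -!(quo_bar q) barK. Qed.

Lemma quotient_bar_neq c : barE c <> c.
Proof.
have [e <-] := quo_surj q c; rewrite -(quo_bar q) => /esym/(quo_edge q)[g ge].
exact: (@no_inversion _ _ g e).
Qed.

Hypothesis cT : in_cyclic_deformation_space T.

Lemma label_gt0 c : 0 < label c.
Proof.
have [e <-] := quo_surj q c; rewrite labelE /edge_index.
by have [] := subgroup_indexP (cT.1 (org e)) (cT.2 e) (@stabe_stabv e).
Qed.

Lemma edge_index1 e : edge_index e = 1%N <-> forall g, stabv (org e) g -> stabe e g.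
Proof. exact: subgroup_index_eq1 (cT.1 _) (cT.2 _) (@stabe_stabv e). Qed.

End Quotient.

Section Exists.
Variables (G : groupType) (T : gtree G).

Lemma vert_orbit_equiv : Equivalence (fun x y : vert T => exists g, y = actv g x).
Proof.
split=> [x|x y [g ->]|x y z [g ->] [h ->]]; first by exists 1; rewrite actv1.
  by exists g^-1; rewrite actvK.
by exists (h * g); rewrite actvM.
Qed.

Lemma edge_orbit_equiv : Equivalence (fun x y : edge T => exists g, y = acte g x).
Proof.
split=> [x|x y [g ->]|x y z [g ->] [h ->]]; first by exists 1; rewrite acte1.
  by exists g^-1; rewrite acteK.
by exists (h * g); rewrite acteM.
Qed.

Lemma finite_quotient_map (F : finType) (s : F -> G) : generates s ->
  exists (V : Type) (E : finType) (orgE : E -> V) (barE : E -> E)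
    (cv : vert T -> V) (ce : edge T -> E), quotient_map orgE barE cv ce.
Proof.
move=> gen; have [F' [r rP]] := finite_edge_orbits T gen.
have [|E [ce [ce_surj ceP]]] := finite_quotient (r := r) edge_orbit_equiv; first exact: rP.
have [_ vsym vtrans] := vert_orbit_equiv.
pose cv x := [set y : vert T | exists g, y = actv g x].
have cvP x y : cv x = cv y <-> exists g, y = actv g x.
  split=> [cxy|xy].
    by have : cv x y; [rewrite cxy; exists 1; rewrite actv1 | case=> g ->; exists g].
  apply/seteqP; split=> z; last exact: vtrans.
  exact/vtrans/vsym.
have /choice[rep repP] := ce_surj.
exists (set (vert T)), E, (fun c => cv (org (rep c))), (fun c => ce (bar (rep c))), cv, ce.
split=> // e; have /ceP[g ge] := repP (ce e).
  by apply/esym/cvP; exists g; rewrite {1}ge acte_org.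
by apply/esym/ceP; exists g; rewrite {1}ge acte_bar.
Qed.

End Exists.

Section Fold.
Variables (G : groupType) (T T' : gtree G).
Variables (fv : vert T -> vert T') (fe : edge T -> edge T') (e1 e2 : edge T) (h : G).
Hypothesis fe_org : forall e, org (fe e) = fv (org e).
Hypothesis fe_bar : forall e, bar (fe e) = fe (bar e).
Hypothesis fv_act : forall g x, fv (actv g x) = actv g (fv x).
Hypothesis fe_act : forall g e, fe (acte g e) = acte g (fe e).
Hypothesis fe_surj : forall e', exists e, fe e = e'.
Hypothesis fvP : forall x y, fv x = fv y <-> fold_eqv e1 e2 x y.
Hypothesis feP : forall e f, fe e = fe f <-> fold_eqe e1 e2 e f.
Hypothesis e12 : e1 <> e2.
Hypothesis hv : stabv (org e1) h.
Hypothesis e2E : e2 = acte h e1.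
Hypothesis nloop : forall g, tgt e1 <> actv g (org e1).

Lemma fe_tgt e : tgt (fe e) = fv (tgt e).
Proof. by rewrite /tgt fe_bar fe_org. Qed.

Lemma fold_vert_orbit x y : fv x = fv y -> exists g, y = actv g x.
Proof.
move/fvP/(_ _ (@vert_orbit_equiv G T)); apply; last by exists h; rewrite e2E tgt_acte.
by move=> g {}x _ [k ->]; exists (g * k * g^-1); rewrite !actvM actvK.
Qed.

Lemma fold_edge_orbit e f : fe e = fe f -> exists g, f = acte g e.
Proof.
move/feP/(_ _ (@edge_orbit_equiv G T)); apply; last by exists h.
  by move=> g {}e _ [k ->]; exists (g * k * g^-1); rewrite !acteM acteK.
by move=> {}e _ [k ->]; exists k; rewrite acte_bar.
Qed.

Lemma fold_quotient_map (V : Type) (E : finType) (orgE : E -> V) barE cv ce :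
  quotient_map orgE barE cv ce -> quotient_map orgE barE (cv \o fv) (ce \o fe).
Proof.
move=> q; split=> /= [x y|e f|c|e|e].
- rewrite (quo_vert q); split=> [[g]|[g ->]]; last by exists g.
  rewrite -fv_act => /esym/fold_vert_orbit[k ->].
  by exists (k * g); rewrite actvM.
- rewrite (quo_edge q); split=> [[g]|[g ->]]; last by exists g.
  rewrite -fe_act => /esym/fold_edge_orbit[k ->].
  by exists (k * g); rewrite acteM.
- by have [e' <-] := quo_surj q c; have [e <-] := fe_surj e'; exists e.
- by rewrite -fe_org (quo_org q).
- by rewrite -fe_bar (quo_bar q).
Qed.

Lemma fe_e12 : fe e1 = fe e2.
Proof. by apply/feP => R _ _ _. Qed.

Lemma h_stab_fold : stabe (fe e1) h.
Proof. by rewrite /stabe /= -fe_act -e2E fe_e12. Qed.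

Lemma stabv_fold x g : stabv x g -> stabv (fv x) g.
Proof. by rewrite /stabv /= -fv_act => ->. Qed.

Lemma stabe_fold e g : stabe e g -> stabe (fe e) g.
Proof. by rewrite /stabe /= -fe_act => ->. Qed.

Lemma stab_tgt (U : gtree G) (e : edge U) g : stabe e g -> stabv (tgt e) g.
Proof. by move/stabe_bar/stabe_stabv. Qed.

Hypothesis cT : in_cyclic_deformation_space T.
Hypothesis cT' : in_cyclic_deformation_space T'.

(** The element h fixes the origin of e1 and g fixes its end.  Both fix the image of
    the end in T', whose stabilizer is cyclic, so g and h commute.  If g moved e1,
    the path e1, g e1^-1, hg e1, h e1^-1 would be a circuit. *)
Lemma stab_tgt_e1 g : stabv (tgt e1) g -> stabe e1 g.
Proof.
move=> gw; apply: contrapT => ge1.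
have gh : g * h = h * g.
  apply: (cyclic_commute (cT'.1 (fv (tgt e1)))); first exact: stabv_fold.
  by rewrite -fe_tgt; apply/stab_tgt/h_stab_fold.
have he1 : acte h e1 <> e1 by rewrite -e2E => /esym.
have gb : acte g (bar e1) <> bar e1 by move/stabe_bar.
suff : [:: e1; acte g (bar e1); acte (h * g) e1; acte h (bar e1)] = [::] by [].
have hv' : actv h (org e1) = org e1 := hv.
have gw' : actv g (tgt e1) = tgt e1 := gw.
apply: (@tree_reduced_closed _ _ (org e1)) => /=.
  rewrite !tgt_acte !acte_org !tgt_bar -/(tgt e1) hv'.
  have hg1 : actv (h * g) (org e1) = actv g (org e1) by rewrite -gh actvM hv'.
  have hg2 : actv (h * g) (tgt e1) = actv h (tgt e1) by rewrite actvM gw'.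
  by rewrite hg1 hg2 gw'; do !split.
move=> [|x1 [|x2 [|x3 [|x4 p1]]]] e p2 //= [].
- by move=> <- /gb.
- move=> _ <-; rewrite -acte_bar barK -gh acteM => /(can_inj (@acteK _ _ g)) /he1 //.
- move=> _ _ <-; rewrite acte_bar acteM => /(can_inj (@acteK _ _ h)) /esym/gb //.
- by case: p1.
Qed.

(** This is the group generated by G_e1 and h. *)
Let K : set G := stabe (fe e1).

Lemma stab_tgt_K g : stabv (tgt e1) g -> K g.
Proof. by move/stab_tgt_e1/stabe_fold. Qed.

(** The relation on the right is an equivalence because G_w <= K, where w is the end of e1. *)
Lemma fold_tgt_translate x y : fv x = fv y ->
  x = y \/ exists g k, [/\ K k, x = actv g (tgt e1) & y = actv g (actv k (tgt e1))].
Proof.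
have [K1 KM KV] := cyclic_closed (cT'.2 (fe e1)).
move/fvP/(_ (fun x y => x = y \/ exists g k,
  [/\ K k, x = actv g (tgt e1) & y = actv g (actv k (tgt e1))])); apply=> /=.
- split=> [z|z z' [->|[g [k [Kk -> ->]]]]
    |z z' z'' [->//|[g [k [Kk -> ->]]]] [<-|[g' [k' [Kk' E' ->]]]]].
  + by left.
  + by left.
  + by right; exists (g * k), k^-1; split; [apply: KV | rewrite actvM | rewrite actvM actvKV].
  + by right; exists g, k.
  right; exists g, (g^-1 * g' * k'); split=> //; last by rewrite !actvM actvKV.
  have Ks : K (g'^-1 * (g * k)).
    by apply: stab_tgt_K; rewrite /stabv /= !actvM E' actvK.
  have -> : g^-1 * g' * k' = k * (g'^-1 * (g * k))^-1 * k'.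
    by rewrite !invgM invgK !mulgA mulgV mul1g.
  by apply: (KM _ _) => //; apply: KM => //; apply: KV.
- move=> g z z' [->|[g' [k [Kk -> ->]]]]; first by left.
  by right; exists (g * g'), k; rewrite !actvM.
- by right; exists 1, h; rewrite !actv1 e2E tgt_acte; split=> //; apply: h_stab_fold.
Qed.

Lemma stab_fold_tgt g : stabv (fv (tgt e1)) g -> K g.
Proof.
have [K1 KM KV] := cyclic_closed (cT'.2 (fe e1)).
rewrite {1}/stabv /= -fv_act => /esym/fold_tgt_translate[/esym/stab_tgt_K//|].
move=> [k [l [Kl kw gw]]]; have Kk : K k by apply: stab_tgt_K.
have Ks : K ((k * l)^-1 * g) by apply: stab_tgt_K; rewrite /stabv /= actvM gw -(actvM k l) actvK.
by rewrite -[g](mulVKg (k * l)); apply: (KM _ _) => //; apply: KM.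
Qed.

Lemma stab_fold_vert x g : (forall k, x <> actv k (tgt e1)) -> stabv (fv x) g -> stabv x g.
Proof.
move=> nx; rewrite {1}/stabv /= -fv_act => /esym/fold_tgt_translate[/esym|[k [_ [_ xk _]]]] //.
by case: (nx k).
Qed.

(** Off the orbits of e1 and its inverse the fold is injective on edges: it suffices to
    compare with the relation that collapses these two orbits completely. *)
Lemma stab_fold_edge e g : (forall k, e <> acte k e1) -> (forall k, e <> acte k (bar e1)) ->
  stabe (fe e) g -> stabe e g.
Proof.
move=> n1 n2; rewrite {1}/stabe /= -fe_act => /esym/feP.
pose O f := exists k, f = acte k e1 \/ f = acte k (bar e1).
have Og k f : O f -> O (acte k f).
  by move=> [l [->|->]]; exists (k * l); rewrite !acteM; [left | right].
have Ob f : O f -> O (bar f).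
  by move=> [l [->|->]]; exists l; rewrite acte_bar ?barK; [right | left].
move/(_ (fun f f' => f = f' \/ O f /\ O f')) => [].
- by split=> [x|x y [->|[]]|x y z [->//|[Ox Oy]] [<-|[]]]; by [left | right].
- by move=> k x y [->|[Ox Oy]]; [left | right; split; apply: Og].
- by move=> x y [->|[Ox Oy]]; [left | right; split; apply: Ob].
- by right; split; [exists 1 | exists h]; left; rewrite ?acte1.
- by [].
- by move=> [[k [/n1|/n2]]].
Qed.

Lemma fold_stab_org g : K g -> stabv (org e1) g.
Proof.
move/stabe_stabv; rewrite fe_org; apply: stab_fold_vert => k /(congr1 (actv k^-1)).
by rewrite actvK => /esym; apply: nloop.
Qed.

(** With w the end of e1, the new stabilizers are K at w and at e1, and the old ones
    elsewhere.  Valence at least 2 at w comes from minimality. *)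
Lemma fold_move (V : Type) (E : finType) (orgE : E -> V) barE cv ce :
  quotient_map orgE barE cv ce ->
  move orgE barE (label ce) (label (ce \o fe)) (ce (fe e1)) (subgroup_index K (stabe e1)).
Proof.
move=> q; have q' := fold_quotient_map q.
have lE e : label ce (ce (fe e)) = edge_index (fe e) by apply: (labelE q).
have lE' e : label (ce \o fe) (ce (fe e)) = edge_index e by apply: (labelE q').
have bE e : barE (ce (fe e)) = ce (fe (bar e)) by rewrite -(quo_bar q').
have oE e : orgE (ce (fe e)) = cv (fv (org e)) by rewrite -(quo_org q').
have cK : infinite_cyclic K := cT'.2 (fe e1).
have KE g : stabe e1 g -> K g by apply: stabe_fold.
have [k_gt0 _] := subgroup_indexP cK (cT.2 e1) KE.
have wK : stabv (fv (tgt e1)) = K.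
  apply/seteqP; split=> g; first exact: stab_fold_tgt.
  by move/stab_tgt; rewrite fe_tgt.
have we : stabv (tgt e1) = stabe e1.
  by apply/seteqP; split=> g; [apply: stab_tgt_e1 | apply: stab_tgt].
have vE x : (forall k, x <> actv k (tgt e1)) -> stabv (fv x) = stabv x.
  by move=> nx; apply/seteqP; split=> g; [apply: stab_fold_vert | apply: stabv_fold].
have eE e : (forall k, e <> acte k e1) -> (forall k, e <> acte k (bar e1)) ->
    stabe (fe e) = stabe e.
  by move=> n1 n2; apply/seteqP; split=> g; [apply: stab_fold_edge | apply: stabe_fold].
have nloop' g : org e1 <> actv g (tgt e1).
  by move/(congr1 (actv g^-1)); rewrite actvK => /esym; apply: nloop.
have bar1 : edge_index (bar e1) = 1%N.
  by apply/(edge_index1 cT) => g; rewrite -/(tgt e1) we => /stabe_bar.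
have bar1' : edge_index (fe (bar e1)) = 1%N.
  apply/(edge_index1 cT') => g; rewrite fe_org -/(tgt e1) wK.
  by rewrite -fe_bar => /stabe_bar.
split.
- rewrite ltn_neqAle k_gt0 andbT eq_sym; apply/eqP => /(subgroup_index_eq1 cK (cT.2 e1) KE)/(_ h).
  by move/(_ h_stab_fold); rewrite /stabe /= -e2E => /esym.
- by rewrite bE lE.
- by rewrite bE !oE => /(quo_vert q')[g]; apply: nloop'.
- have [f [fo fb]] := minimal_no_leaf nloop'.
  exists (ce (fe f)); split; first by rewrite bE !oE fo.
  rewrite bE => /(quo_edge q')[g gf]; apply: fb.
  have : stabv (tgt e1) g by rewrite /stabv /= -{1}fo -acte_org -gf.
  by rewrite we => /stabe_bar gb; rewrite -[f](acteK g) -gf -{1}gb acteK.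
- rewrite lE lE' /edge_index mulnC fe_org vE //.
  exact: subgroup_indexM (cT.1 _) cK (cT.2 e1) fold_stab_org KE.
- move=> f; have [f0 <-] := quo_surj q' f => /= -[]; rewrite bE !oE.
  move/esym/(quo_vert q')=> [g gf0] nb.
  have [f1 f1E] : exists f1, f1 = acte g^-1 f0 by exists (acte g^-1 f0).
  have ff1 : f0 = acte g f1 by rewrite f1E acteKV.
  have of1 : org f1 = tgt e1 by rewrite f1E acte_org gf0 actvK.
  have <- : ce (fe f1) = ce (fe f0) by apply/(quo_edge q'); exists g.
  rewrite lE lE' /edge_index fe_org of1 wK we.
  have f1K : stabe (fe f1) = stabe f1.
    apply: eE => k f1k; first by apply: (nloop (g := k)); rewrite -of1 f1k acte_org.
    apply: nb; apply/(quo_edge q'); exists (g * k)^-1.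
    by rewrite ff1 f1k -(acteM g k) acteK.
  rewrite f1K; apply: subgroup_indexM cK (cT.2 e1) (cT.2 f1) KE _ => k /stabe_stabv.
  by rewrite of1 we.
- move=> f; have [f0 <-] := quo_surj q' f => /= nf nsucc; rewrite lE lE'.
  case: (pselect (exists k, f0 = acte k (bar e1))) => [[k ->]|nb].
    by rewrite fe_act !edge_index_act bar1 bar1'.
  have ne k : f0 <> acte k e1.
    move=> f0k; apply: nf; apply/(quo_edge q'); exists k^-1.
    by rewrite f0k acteK.
  have nb' k : f0 <> acte k (bar e1) by move=> f0k; apply: nb; exists k.
  rewrite /edge_index fe_org vE ?eE // => k ok; apply: nsucc; split.
    by rewrite bE !oE; apply/(quo_vert q'); exists k^-1; rewrite ok actvK.
  rewrite bE => /(quo_edge q')[g gf0]; apply: (nb' g^-1).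
  by rewrite gf0 acteK.
Qed.

End Fold.

(** * Words and presentations of solvable Baumslag-Solitar groups *)

Section Words.
Variables (X : Type) (R : word X -> word X -> Prop).

#[local] Instance word_eq_equivalence : Equivalence (word_eq R).
Proof.
split; [exact: weq_refl | exact: weq_sym | exact: weq_trans].
Qed.

#[local] Instance cat_word_eq : 
  Morphisms.Proper (Morphisms.respectful (word_eq R)
    (Morphisms.respectful (word_eq R) (word_eq R))) (@cat (X * bool)).
Proof. by move=> u u' uu' v v' vv'; apply: weq_cat. Qed.

#[local] Instance cons_word_eq l :
  Morphisms.Proper (Morphisms.respectful (word_eq R) (word_eq R)) (@cons (X * bool) l).
Proof. by move=> v v' vv'; apply: (weq_cat (weq_refl R [:: l]) vv'). Qed.

Definition inv_word (w : word X) : word X := rev [seq (l.1, ~~ l.2) | l <- w].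

Lemma inv_word_cons x b w : inv_word ((x, b) :: w) = inv_word w ++ [:: (x, ~~ b)].
Proof. by rewrite /inv_word /= rev_cons -cats1. Qed.

Lemma cat_inv_word w : word_eq R (w ++ inv_word w) [::].
Proof.
elim: w => [|[x b] w IHw]; first exact: weq_refl.
rewrite inv_word_cons -cat1s -catA (catA w).
by rewrite IHw; apply: weq_cancel.
Qed.

Lemma inv_word_cat w : word_eq R (inv_word w ++ w) [::].
Proof.
elim: w => [|[x b] w IHw]; first exact: weq_refl.
rewrite inv_word_cons -catA -[[:: (x, ~~ b)] ++ _]/([:: (x, ~~ b); (x, b)] ++ w).
by have := weq_cancel R x (~~ b); rewrite negbK => ->.
Qed.

Variables (G : groupType) (f : X -> G).

Lemma eval_word_cat u v : eval_word f (u ++ v) = eval_word f u * eval_word f v.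
Proof. by rewrite /eval_word big_cat. Qed.

Lemma eval_word_eq u v : (forall u v, R u v -> eval_word f u = eval_word f v) ->
  word_eq R u v -> eval_word f u = eval_word f v.
Proof.
move=> fR; elim=> //.
- by move=> w1 w2 w3 _ -> _ ->.
- by move=> u1 u2 v1 v2 _ e1 _ e2; rewrite !eval_word_cat e1 e2.
- by move=> x [] /=; rewrite /eval_word !big_cons big_nil /= mulg1 ?mulgV ?mulVg.
Qed.

(** Words form a group modulo the relations, so that the kernel decides equality. *)
Lemma presented_by_kernel : (forall g, exists w, eval_word f w = g) ->
  (forall u v, R u v -> eval_word f u = eval_word f v) ->
  (forall w, eval_word f w = 1 -> word_eq R w [::]) -> presented_by G R.
Proof.
move=> f_surj fR ker; exists f; split=> // u v; split=> [uv|]; last exact: eval_word_eq.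
have ->: word_eq R u (u ++ (inv_word v ++ v)).
  by rewrite inv_word_cat cats0; apply: weq_refl.
rewrite catA (ker (u ++ inv_word v)); first exact: weq_refl.
rewrite eval_word_cat uv -eval_word_cat.
by rewrite (eval_word_eq fR (cat_inv_word v)) /eval_word big_nil.
Qed.

End Words.
#[local] Existing Instance word_eq_equivalence.
#[local] Existing Instance cat_word_eq.
#[local] Existing Instance cons_word_eq.

Section BaumslagSolitar.
Variable n : int.
Local Notation "u ≡ v" := (word_eq (bs_rel n) u v) (at level 70).
Local Notation A := bs_a_power.
Local Notation t := (bs_t, false).
Local Notation t' := (bs_t, true).

Lemma bs_a_powerS (b : bool) (k : nat) :
  A ((-1) ^+ b * k.+1%:Z)%R = (bs_a, b) :: A ((-1) ^+ b * k%:Z)%R.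
Proof.
rewrite /A !abszMsign; case: b; last by rewrite expr0 !mul1r.
by rewrite expr1 !mulN1r !oppr_lt0 ltz_nat /=; case: k => [|k] //; rewrite oppr_lt0.
Qed.

(** Either the letter lengthens the power or it cancels against it. *)
Lemma cons_bs_a_power (b : bool) (m : int) : (bs_a, b) :: A m ≡ A ((-1) ^+ b + m)%R.
Proof.
have [[k ->]|[k ->]] : (exists k : nat, m = (-1) ^+ b * k%:Z)%R \/
    (exists k : nat, m = (-1) ^+ (~~ b) * k.+1%:Z)%R.
- by case: b (intP m) => [[|k|k]|[|k|k]]; [left; exists 0 | right; exists k | left; exists k.+1
   | left; exists 0 | left; exists k.+1 | right; exists k];
   rewrite ?expr1 ?expr0 ?mulN1r ?mul1r ?oppr0.
- by rewrite -bs_a_powerS intS mulrDr mulr1; apply: weq_refl.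
- rewrite bs_a_powerS -[[:: _, _ & _]]/([:: (bs_a, b); (bs_a, ~~ b)] ++ _) weq_cancel.
  have -> : ((-1) ^+ b + (-1) ^+ (~~ b) * k.+1%:Z = (-1) ^+ (~~ b) * k%:Z :> int)%R.
    by rewrite intS mulrDr mulr1 addrA; case: b; rewrite add0r.
  exact: weq_refl.
Qed.

Lemma bs_a_power_sign (m : int) : exists (b : bool) (k : nat), m = ((-1) ^+ b * k%:Z)%R.
Proof.
exists (m < 0)%R, `|m|; rewrite {1}[m]intEsign //.
Qed.


Lemma bs_a_powerD m m' : A m ++ A m' ≡ A (m + m')%R.
Proof.
have [b [k ->]] := bs_a_power_sign m.
elim: k => [|k IHk]; first by rewrite mulr0 add0r; apply: weq_refl.
rewrite bs_a_powerS -cat1s -catA IHk cat1s cons_bs_a_power addrA.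
rewrite intS mulrDr mulr1; exact: weq_refl.
Qed.

Lemma bs_t_letter (b : bool) : [:: t; (bs_a, b)] ≡ A (n * (-1) ^+ b)%R ++ [:: t].
Proof.
have ta : [:: t; (bs_a, false)] ≡ A n ++ [:: t].
  rewrite -(weq_rel (bs_relI n)) /= -[[:: _, _, _ & _]]/([:: t; (bs_a, false)] ++ [:: t'; t]).
  by rewrite (weq_cancel _ bs_t true) cats0; apply: weq_refl.
case: b; last by rewrite expr0 mulr1.
have -> : A (n * (-1) ^+ true)%R ++ [:: t]
    ≡ A (n * (-1) ^+ true)%R ++ [:: t; (bs_a, false)] ++ [:: (bs_a, true)].
  rewrite /= -[[:: t; _; _]]/([:: t] ++ [:: (bs_a, false); (bs_a, true)]).
  by rewrite (weq_cancel _ bs_a false) cats0; apply: weq_refl.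
rewrite ta -catA catA bs_a_powerD expr1 mulrN1 addNr; exact: weq_refl.
Qed.

Lemma bs_t_a_power m : t :: A m ≡ A (n * m)%R ++ [:: t].
Proof.
have [b [k ->]] := bs_a_power_sign m.
elim: k => [|k IHk]; first by rewrite !mulr0; apply: weq_refl.
rewrite bs_a_powerS -[[:: _, _ & _]]/([:: t; (bs_a, b)] ++ _) bs_t_letter.
rewrite -catA cat1s IHk catA bs_a_powerD -mulrDr intS (mulrDr _ 1%R) mulr1.
exact: weq_refl.
Qed.

Lemma bs_a_power_t' m : A m ++ [:: t'] ≡ t' :: A (n * m)%R.
Proof.
rewrite -[X in _ ≡ X]cat1s.
have <- : [:: t'] ++ ((A (n * m)%R ++ [:: t]) ++ [:: t']) ≡ [:: t'] ++ A (n * m)%R.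
  rewrite -(catA (A _)) -[[:: t] ++ _]/[:: t; t'] (weq_cancel _ bs_t false).
  rewrite cats0; apply: weq_refl.
rewrite -bs_t_a_power -[[:: t'] ++ _]/([:: t'; t] ++ (A m ++ [:: t'])) (weq_cancel _ bs_t true).
exact: weq_refl.
Qed.

Lemma bs_a_power_t'n m b : A m ++ nseq b t' ≡ nseq b t' ++ A (n ^+ b * m)%R.
Proof.
elim: b m => [|b IHb] m; first by rewrite expr0 mul1r cats0; apply: weq_refl.
rewrite -[nseq b.+1 t']/([:: t'] ++ nseq b t') catA bs_a_power_t' cat_cons IHb.
rewrite exprSr mulrA; exact: weq_refl.
Qed.

Definition bs_normal_word b m c : word bs_gen := nseq b t' ++ A m ++ nseq c t.

(** Multiplying a normal word by one letter on the left again gives a normal word, by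
    moving a to the right past negative powers of t and t past powers of a. *)
Lemma bs_normal_form w : exists b m c, w ≡ bs_normal_word b m c.
Proof.
elim: w => [|[[] e] w [b [m [c wE]]]]; first by exists 0, 0%R, 0; apply: weq_refl.
- exists b, (n ^+ b * (-1) ^+ e + m)%R, c; rewrite -cat1s wE /bs_normal_word.
  have -> : [:: (bs_a, e)] ≡ A ((-1) ^+ e)%R.
    by have := cons_bs_a_power e 0; rewrite addr0.
  by rewrite catA bs_a_power_t'n -catA (catA (A _)) bs_a_powerD; apply: weq_refl.
- case: e; first by exists b.+1, m, c; rewrite -cat1s wE; apply: weq_refl.
  case: b wE => [|b] wE.
    exists 0, (n * m)%R, c.+1; rewrite -cat1s wE /bs_normal_word /= -cat_cons bs_t_a_power.
    by rewrite -catA; apply: weq_refl.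
  exists b, m, c; rewrite -cat1s wE /bs_normal_word.
  rewrite -[[:: t] ++ _]/([:: t; t'] ++ (nseq b t' ++ A m ++ nseq c t)).
  by rewrite (weq_cancel _ bs_t false); apply: weq_refl.
Qed.

End BaumslagSolitar.

(** The hypotheses on normal words provide surjectivity and a trivial kernel: if such
    a word has value 1, then b = c and f m is conjugate to 1. *)
Lemma solvable_BS_criterion (G : groupType) (f : int -> G) (s : G) (n : int) :
  n <> 0%R -> injective f -> (forall x y, f (x + y)%R = f x * f y) ->
  s * f 1%R * s^-1 = f n ->
  (forall g, exists b m c, g = s ^- b * f m * s ^+ c) ->
  (forall b m c, s ^- b * f m * s ^+ c = 1 -> b = c) ->
  solvable_BS G.
Proof.
move=> n0 f_inj fD sf gen sbc; exists n => //.
pose phi (x : bs_gen) := if x is bs_a then f 1%R else s.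
have evA m : eval_word phi (bs_a_power m) = f m.
  have evX (b : bool) k : eval_word phi (nseq k (bs_a, b)) = (if b then (f 1%R)^-1 else f 1%R) ^+ k.
    rewrite /eval_word; elim: k => [|k IHk]; first by rewrite big_nil.
    by rewrite big_cons IHk expgS.
  rewrite evX; case: (intP m) => [|k|k]; rewrite ?(param0 fD) //=.
    by rewrite -(paramX fD) natz.
  by rewrite expVgn -(paramX fD) natz (paramN fD).
have evX (b : bool) k : eval_word phi (nseq k (bs_t, b)) = (if b then s^-1 else s) ^+ k.
  rewrite /eval_word; elim: k => [|k IHk]; first by rewrite big_nil.
  by rewrite big_cons IHk expgS.
have evN b m c : eval_word phi (bs_normal_word b m c) = s ^- b * f m * s ^+ c.
  by rewrite /bs_normal_word !eval_word_cat !evX evA expVgn mulgA.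
have rel u v : bs_rel n u v -> eval_word phi u = eval_word phi v.
  by case; rewrite evA /eval_word !big_cons big_nil /= mulg1 mulgA.
apply: (@presented_by_kernel _ _ _ phi) => // [g|w].
  by have [b [m [c ->]]] := gen g; exists (bs_normal_word b m c).
have [b [m [c wN]]] := bs_normal_form n w.
rewrite (eval_word_eq rel wN) evN => E.
have bc := sbc _ _ _ E; rewrite -{}bc in E wN.
have m0 : m = 0%R.
  apply: f_inj; rewrite (param0 fD); apply: (mulgI (s ^- b)); rewrite mulg1.
  by apply: (mulIg (s ^+ b)); rewrite E mulVg.
rewrite wN m0 /bs_normal_word /=; elim: b {E wN} => [|b IHb]; first exact: weq_refl.
rewrite -[nseq b.+1 (bs_t, false)]/([:: (bs_t, false)] ++ nseq b (bs_t, false)).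
have -> : nseq b.+1 (bs_t, true) = nseq b (bs_t, true) ++ [:: (bs_t, true)].
  by rewrite -[b.+1]addn1 nseqD.
rewrite -catA -[[:: (bs_t, true)] ++ _]/([:: (bs_t, true); (bs_t, false)] ++ nseq b (bs_t, false)).
rewrite (weq_cancel _ bs_t true); exact: IHb.
Qed.

(** * Actions fixing an end *)

(** U is the set of edges pointing towards a fixed end. *)
Section FixedEnd.
Variables (G : groupType) (T : gtree G) (U : set (edge T)).
Hypothesis U_act : forall g e, U e -> U (acte g e).
Hypothesis U_ex : forall x, exists u, U u /\ org u = x.
Hypothesis U_uniq : forall u u', U u -> U u' -> org u = org u' -> u = u'.
Hypothesis U_bar : forall u, U u -> ~ U (bar u).
Hypothesis U_all : forall e, U e \/ U (bar e).

Definition up x := sval (cid (U_ex x)).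
Definition parent x := tgt (up x).

Lemma up_U x : U (up x). Proof. exact: (svalP (cid (U_ex x))).1. Qed.
Lemma org_up x : org (up x) = x. Proof. exact: (svalP (cid (U_ex x))).2. Qed.

Lemma parent_tgt u : U u -> parent (org u) = tgt u.
Proof.
by move=> Uu; rewrite /parent (U_uniq (up_U (org u)) Uu) // org_up.
Qed.

Lemma parent_act g x : parent (actv g x) = actv g (parent x).
Proof.
rewrite -{1}(org_up x) -acte_org parent_tgt ?tgt_acte //.
exact/U_act/up_U.
Qed.

Lemma iter_parent_act n g x : iter n parent (actv g x) = actv g (iter n parent x).
Proof. by elim: n => //= n ->; rewrite parent_act. Qed.

Fixpoint ascent n x : seq (edge T) :=
  if n is n'.+1 then up x :: ascent n' (parent x) else [::].

Lemma walk_ascent n x : walk setT x (ascent n x) (iter n parent x).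
Proof.
by elim: n x => //= n IHn x; split; rewrite ?org_up // -iterS iterSr; apply: IHn.
Qed.

Lemma ascent_reduced n x : reduced (ascent n x).
Proof.
move=> p1 e p2; elim: p1 n x => [|a p1 IHp] [|n] x //=; last by case=> _; apply: IHp.
case: n => [//|n] /= [eE bE _]; apply: (@U_bar e); first by rewrite -eE; apply: up_U.
by rewrite -bE; apply: up_U.
Qed.

Lemma iter_parent_neq n x : iter n.+1 parent x <> x.
Proof.
move=> nx; have := walk_ascent n.+1 x; rewrite nx => w.
by have := tree_reduced_closed w (@ascent_reduced n.+1 x).
Qed.

(** Crossing an edge of a walk in either direction moves to the parent or to a child. *)
Lemma common_ancestor x y : exists i j, iter i parent x = iter j parent y.
Proof.
have [p] := tree_connected x y; elim: p x => [x ->|e p IHp x] /=; first by exists 0, 0.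
move=> [_ <- /IHp[i [j ij]]]; case: (U_all e) => Ue.
  by exists i.+1, j; rewrite iterSr parent_tgt.
exists i, j.+1; rewrite iterS -ij -iterS iterSr; congr iter.
by rewrite -(tgt_bar e) -parent_tgt.
Qed.

Lemma stabv_parent x g : stabv x g -> stabv (parent x) g.
Proof. by rewrite /stabv /= -parent_act => ->. Qed.

Lemma stabv_iter_parent n x g : stabv x g -> stabv (iter n parent x) g.
Proof. by move=> xg; elim: n => //= n; apply: stabv_parent. Qed.

Hypothesis cT : in_cyclic_deformation_space T.
Variables (x : vert T) (r : nat) (t : G).
Hypothesis r_gt0 : 0 < r.
Hypothesis rx : iter r parent x = actv t x.
Hypothesis r_min : forall j g, 0 < j -> iter j parent x = actv g x -> r <= j.

Lemma iter_parent_expg k : iter (k * r) parent x = actv (t ^+ k) x.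
Proof.
elim: k => [|k IHk]; first by rewrite actv1.
by rewrite mulSn addnC iterD rx iter_parent_act IHk -actvM expgS.
Qed.

(** Divide j by r and use the minimality of r for the remainder. *)
Lemma dvdn_iter_parent j g : iter j parent x = actv g x -> r %| j.
Proof.
rewrite {1}(divn_eq j r) addnC iterD iter_parent_expg iter_parent_act.
move/(congr1 (actv (t ^- (j %/ r)))); rewrite actvK -actvM => jg.
rewrite /dvdn -leqn0 leqNgt; apply/negP => /r_min/(_ jg).
by rewrite leqNgt ltn_mod r_gt0.
Qed.

(** A common ancestor of g x and x lies in the orbit of x once its height
    over g x is raised to a multiple of r. *)
Lemma parent_normal_form g : exists b z c, stabv x z /\ g = t ^+ b * z * t ^- c.
Proof.
have [i [j ij]] := common_ancestor (actv g x) x.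
pose d := i * r - i; have le_i : i <= i * r by rewrite leq_pmulr.
have : iter (i * r) parent (actv g x) = iter (d + j) parent x.
  by rewrite iterD -ij -iterD subnK.
rewrite iter_parent_act iter_parent_expg -actvM => gE.
have /dvdnP[k kE] := dvdn_iter_parent (esym gE); rewrite kE iter_parent_expg in gE.
exists k, (t ^- k * (g * t ^+ i)), i; split; last by rewrite mulVKg mulgK.
by rewrite /stabv /= actvM gE actvK.
Qed.

(** G_x fixes every ancestor of x, in particular t x, so t^-1 conjugates G_x into itself.
    The exponents b and c of a trivial normal word agree because no vertex is its
    own proper ancestor. *)
Theorem fixed_end_solvable_BS : solvable_BS G.
Proof.
have [f [f_inj fD fx]] := cT.1 x.
have xf z : stabv x (f z) by rewrite -fx; exists z.
have [n _ fn] : range f (t^-1 * f 1%R * t).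
  rewrite fx /stabv /= !actvM -rx.
  have := stabv_iter_parent r (xf 1%R); rewrite /stabv /= => ->.
  by rewrite rx actvK.
apply: (@solvable_BS_criterion _ f t^-1 n) => //; last first.
- move=> b m c E.
  have tE : t ^+ b * f m = t ^+ c.
    by apply/eqP; rewrite -divg_eq1; apply/eqP; rewrite -{}E !expVgn !invgK.
  have : iter (b * r) parent x = iter (c * r) parent x.
    by rewrite !iter_parent_expg -tE actvM; have -> : actv (f m) x = x := xf m.
  move=> bc; apply: contrapT => /eqP; wlog lt_bc : b c bc {E tE} / b < c.
    move=> wl; rewrite neq_ltn => /orP[lt|lt]; first by apply: (wl b c) => //; rewrite ltn_eqF.
    by apply: (wl c b) => //; rewrite ltn_eqF.
  move=> _; have : iter ((c - b) * r) parent (iter (b * r) parent x) = iter (b * r) parent x.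
    by rewrite -iterD -mulnDl subnK ?bc // ltnW.
  have : 0 < (c - b) * r by rewrite muln_gt0 subn_gt0 lt_bc.
  by case: ((c - b) * r)%N => // k _; apply: iter_parent_neq.
- move=> g; have [b [z [c [xz ->]]]] := parent_normal_form g.
  have [m _ <-] : range f z by rewrite fx.
  by exists b, m, c; rewrite !expVgn invgK.
- by rewrite invgK fn.
- move=> n0; have : f 1%R = f 0%R; last by move/f_inj.
  rewrite (param0 fD); apply: (mulgI t^-1); apply: (mulIg t).
  by rewrite -fn n0 (param0 fD) mulg1 mulVg.
Qed.

End FixedEnd.

(** Finitely many orbits force two ancestors of some vertex into one orbit. *)
Lemma fixed_end_cofinite_solvable_BS (G : groupType) (T : gtree G) (U : set (edge T))
    (E : finType) (ce : edge T -> E) :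
  in_cyclic_deformation_space T ->
  (forall g e, U e -> U (acte g e)) ->
  (forall x, exists u, U u /\ org u = x) ->
  (forall u u', U u -> U u' -> org u = org u' -> u = u') ->
  (forall u, U u -> ~ U (bar u)) ->
  (forall e, U e \/ U (bar e)) ->
  (forall e f, ce e = ce f -> exists g, f = acte g e) ->
  solvable_BS G.
Proof.
move=> cT U_act U_ex U_uniq U_bar U_all ceP.
have [_ [x0 _] _ _] := gt_tree T.
pose par := parent U_ex.
have [x [r [t [r_gt0 rx]]]] : exists x r t, 0 < r /\ iter r par x = actv t x.
  pose h (i : 'I_#|E|.+1) := ce (up U_ex (iter i par x0)).
  have /injectivePn[i [j nij hij]] : ~~ injectiveb h.
    by apply/negP => /injectiveP/leq_card; rewrite card_ord ltnn.
  wlog lt_ij : i j nij hij / i < j.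
    move=> wl; case: (ltngtP i j) => [lt|lt|/val_inj eij]; first exact: (wl i j).
      by apply: (wl j i) => //; rewrite eq_sym.
    by rewrite eij eqxx in nij.
  have [g /(congr1 (@org T))] := ceP _ _ hij; rewrite acte_org !org_up => gij.
  exists (iter i par x0), (j - i), g; split; first by rewrite subn_gt0.
  by rewrite -iterD subnK // ltnW.
have exP : exists j, `[< 0 < j /\ exists g, iter j par x = actv g x >].
  by exists r; apply/asboolP; split=> //; exists t.
case: (ex_minnP exP) => r' /asboolP[r'_gt0 [t' r'x]] r_min.
apply: (@fixed_end_solvable_BS G T U U_act U_ex U_uniq U_bar U_all cT x r' t') => //.
by move=> j g j_gt0 jg; apply/r_min/asboolP; split=> //; exists g.
Qed.

(** * From a quotient circle to a solvable Baumslag-Solitar group *)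

Lemma type_II_fold_move (G : groupType) (T T' : gtree G) (V : Type) (E : finType)
    (orgE : E -> V) (barE : E -> E) (cv : vert T' -> V) (ce : edge T' -> E) :
  in_cyclic_deformation_space T -> in_cyclic_deformation_space T' ->
  type_II_fold T T' -> quotient_map orgE barE cv ce ->
  exists (cv' : vert T -> V) (ce' : edge T -> E), quotient_map orgE barE cv' ce' /\
    exists g k, move orgE barE (label ce) (label ce') g k.
Proof.
move=> cT cT' [e1 [e2 [h [[oe e12 _ [fv [fe fP]]] hv e2E nloop]]]] q.
have [[fo fb] [fva fea] [_ fs] fvP feP] := fP.
exists (cv \o fv), (ce \o fe); split.
  exact: (@fold_quotient_map _ _ _ fv fe e1 e2 h).
exists (ce (fe e1)), (subgroup_index (stabe (fe e1)) (stabe e1)).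
exact: (fold_move fo fb fva fea fs fvP feP e12 hv e2E nloop cT cT' q).
Qed.

Section Circle.
Variables (G : groupType) (T : gtree G) (V : Type) (E : finType).
Variables (orgE : E -> V) (barE : E -> E) (cv : vert T -> V) (ce : edge T -> E).
Hypothesis q : quotient_map orgE barE cv ce.
Hypothesis cT : in_cyclic_deformation_space T.

(** The vertices with an outgoing edge in U are closed under adjacency, so U gives every
    vertex of T an edge towards an end; label 1 makes that edge unique. *)
Lemma circle_solvable_BS (U : set E) :
  (exists u, U u) -> (forall u, U u -> label ce u = 1%N) ->
  (forall u, U u -> ~ U (barE u)) ->
  (forall u e, U u -> orgE e = orgE u -> e = u \/ U (barE e)) ->
  (forall u, U u -> exists2 u', U u' & orgE (barE u) = orgE u') ->
  solvable_BS G.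
Proof.
move=> [u0 Uu0] lab1 Ubar Uorg Utgt.
have ce_act g e : ce (acte g e) = ce e by apply/esym/(quo_edge q); exists g.
have same_org e f : org e = org f -> U (ce f) -> ce e = ce f \/ U (barE (ce e)).
  by move=> ef Uf; apply: Uorg => //; rewrite -!(quo_org q) ef.
have U_ex x : exists u, U (ce u) /\ org u = x.
  have [e0 e0E] := quo_surj q u0.
  have [p] := tree_connected (org e0) x.
  have : exists u, U (ce u) /\ org u = org e0 by exists e0; rewrite e0E.
  move: (org e0) => y; elim: p y => [y ux <- //|e p IHp y [u [Uu uy]] [_ ey w]].
  apply: IHp w; case: (same_org e u _ Uu) => [||Ue]; first by rewrite uy.
    move=> eu; rewrite -eu in Uu; have [u' Uu'] := Utgt _ Uu.
    have [e' e'E] := quo_surj q u'; rewrite -{}e'E in Uu' *.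
    rewrite -(quo_bar q) -!(quo_org q) => /esym/(quo_vert q)[g ge].
    by exists (acte g e'); rewrite ce_act acte_org -ge.
  by exists (bar e); rewrite (quo_bar q).
apply: (@fixed_end_cofinite_solvable_BS G T (fun e => U (ce e)) E ce) => //.
- by move=> g e; rewrite ce_act.
- move=> u u' Uu Uu' uu'; case: (same_org u u' uu' Uu') => [/(quo_edge q)[g u'E]|Ub].
    have : stabv (org u) g by rewrite /stabv /= -acte_org -u'E.
    by move/(proj1 (edge_index1 cT u) (etrans (esym (labelE q u)) (lab1 _ Uu))); rewrite u'E.
  by case: (Ubar _ Uu).
- by move=> u; rewrite (quo_bar q); apply: Ubar.
- move=> e; have [u [Uu ue]] := U_ex (org e).
  case: (same_org e u (esym ue) Uu) => [->|]; first by left.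
  by rewrite (quo_bar q); right.
- by move=> e f /(quo_edge q).
Qed.

End Circle.

Theorem lemma3 (G : groupType)
  (hGBS : GBS_group G) (hne : non_elementary G) (hBS : ~ solvable_BS G) :
  ~ exists T : nat -> gtree G,
      (forall i : nat, in_cyclic_deformation_space (T i)) /\
      (forall i : nat, type_II_fold (T i.+1) (T i)).
Proof.
move=> [T [cT foldT]]; apply: hBS.
have [F [s gen]] := GBS_finitely_generated hGBS.
have [V [E [orgE [barE [cv0 [ce0 q0]]]]]] := finite_quotient_map (T 0) gen.
pose Q i := {c : (vert (T i) -> V) * (edge (T i) -> E) | quotient_map orgE barE c.1 c.2}.
have step i (c : Q i) : {c' : Q i.+1 |
    exists g k, move orgE barE (label (sval c).2) (label (sval c').2) g k}.
  apply: cid; have [cv [ce [q mv]]] := type_II_fold_move (cT _) (cT _) (foldT i) (svalP c).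
  by exists (exist _ (cv, ce) q).
pose c := nat_rect Q (exist _ (cv0, ce0) q0) (fun i ci => sval (step i ci)).
pose lam i := label (sval (c i)).2.
have mv i : exists gk : E * nat, move orgE barE (lam i) (lam i.+1) gk.1 gk.2.
  by have [g [k m]] := svalP (step i (c i)); exists (g, k).
have [gk gkP] := choice mv.
have q i : quotient_map orgE barE (sval (c i)).1 (sval (c i)).2 := svalP (c i).
have lam_gt0 i e : 0 < lam i e by apply: label_gt0 (q i) (cT i) e.
have [t [U [Uex lab1 Ubar Uorg Utgt]]] := infinite_moves_circle
  (quotient_barK (q 0)) (quotient_bar_neq (q 0)) lam_gt0 gkP.
exact (circle_solvable_BS (q t) (cT t) Uex lab1 Ubar Uorg Utgt).
Qed.
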